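(* Let $0<\beta\leq 1$ and $0<\alpha<1$. (i) Let $u\in C^{0,\beta}(\mathbb{R})$ and $\alpha<\beta$. Then $$\big\| (\delta_{\rm right})^{\alpha}(r_h u)-r_h\big((D_{\rm right})^{\alpha}u\big)\big\|_{\ell^{\infty}}\leq C_{\alpha}\,[u]_{C^{0,\beta}(\mathbb{R})}\,h^{\beta-\alpha}.$$ (ii) Let $u\in C^{1,\beta}(\mathbb{R})$ and $\alpha<\beta$. Then $$\Big\| -\delta_{\rm right}(\delta_{\rm right})^{\alpha}(r_h u)-r_h\Big(\frac{d}{dx}(D_{\rm right})^{\alpha}u\Big)\Big\|_{\ell^{\infty}}\leq C_{\alpha}\,[u]_{C^{1,\beta}(\mathbb{R})}\,h^{\beta-\alpha}.$$
   Context: Here $h>0$ and $\mathbb{Z}_h=\{jh: j\in\mathbb{Z}\}$. For a function $u$ defined on $\mathbb{R}$, its restriction (discretization) $r_hu$ to $\mathbb{Z}_h$ is $r_hu(j)=u(hj)$, $j\in\mathbb{Z}$ (a function on $\mathbb{Z}_h$, with the point $jh$ indexed by $j$); $\|\cdot\|_{\ell^\infty}$ is the supremum over $j\in\mathbb{Z}$. $C_\alpha$ denotes a positive constant, the subindex emphasizing that it depends on $\alpha$. For a function $w$ on $\mathbb{Z}_h$, $\delta_{\rm right}w(nh)=\frac{w(nh)-w((n+1)h)}{h}$ and, for $0<\alpha<1$, $$(\delta_{\rm right})^{\alpha}w(nh)=\frac{1}{h^{\alpha}}\sum_{j=0}^{\infty}\big(w((n+j)h)-w(nh)\big)\Lambda^\alpha(j),\qquad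 \Lambda^\alpha(m)=\binom{-\alpha-1+m}{m}=(-1)^m\binom{\alpha}{m}.$$ The operator $(D_{\rm right})^{\alpha}$ is the Marchaud derivative $$(D_{\rm right})^{\alpha}f(x)=\frac{1}{\Gamma(-\alpha)}\int_0^{\infty}\frac{f(x+t)-f(x)}{t^{1+\alpha}}\,dt.$$ The classes $C^{k,\beta}(\mathbb{R})$, $k\in\mathbb{N}_0$, are the usual Hölder classes on the real line: a continuous real function $u$ belongs to $C^{k,\beta}(\mathbb{R})$ if $u\in C^k(\mathbb{R})$ and $[u^{(k)}]_{C^{0,\beta}(\mathbb{R})}=\sup_{x\neq y\in\mathbb{R}}\frac{|u^{(k)}(x)-u^{(k)}(y)|}{|x-y|^{\beta}}<\infty$, where $u^{(k)}$ is the $k$-th derivative; the norm in $C^{k,\beta}(\mathbb{R})$ is $\|u\|_{C^{k,\beta}(\mathbb{R})}=\sum_{l=0}^k\|u^{(l)}\|_{L^\infty(\mathbb{R})}+[u^{(k)}]_{C^{0,\beta}(\mathbb{R})}$. The symbol $[u]_{C^{1,\beta}(\mathbb{R})}$ means $[u']_{C^{0,\beta}(\mathbb{R})}$.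
   Formalization: The constant C_α may depend on β as well as α (no constant uniform as β↓α exists); the estimate is claimed whenever the Marchaud integral of u converges absolutely at every x, which is proved when the C^{k,β} norm is finite. *)

(* Defs.v *)
From HB Require Import structures.
From mathcomp Require Import all_boot all_order all_algebra.
From mathcomp Require Import ring lra.
From mathcomp Require Import all_classical all_reals all_analysis.

Set Implicit Arguments.
Unset Strict Implicit.
Unset Printing Implicit Defensive.

Import Order.TTheory GRing.Theory Num.Theory.
Import numFieldNormedType.Exports.

Local Open Scope classical_set_scope.
Local Open Scope ring_scope.

Section Defs.
Context {R : realType}.
Implicit Types (u f : R -> R) (w : int -> R) (alpha beta h s x : R).

Local Notation mu := (@lebesgue_measure R).

(** Generalized binomial coefficient, with real upper argument. *)
Definition gbinom (a : R) (m : nat) : R :=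
  (\prod_(i < m) (a - i%:R)) / (m`!)%:R.

Definition Lambda alpha (m : nat) : R := gbinom (- alpha - 1 + m%:R) m.

Lemma LambdaE alpha m : Lambda alpha m = (-1) ^+ m * gbinom alpha m.
Proof.
rewrite /Lambda /gbinom mulrA; congr (_ / _).
rewrite -[in X in X * _](card_ord m) -prodrN (reindex_inj rev_ord_inj) /=.
apply: eq_bigr => i _; rewrite natrB; last exact: ltn_ord.
by rewrite -natr1; lra.
Qed.

(** A function on the mesh [h Z] is encoded as [w : int -> R], where [w n] is
    the value at the point [n h]. *)
Definition restr h u : int -> R := fun n => u (h * n%:~R).

Definition delta_right h w : int -> R := fun n => (w n - w (n + 1)) / h.

Definition frac_delta_term alpha w (n : int) (j : nat) : R :=
  (w (n + j%:Z) - w n) * Lambda alpha j.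

(** [limn] is total: the value below is meaningful only under
    [frac_delta_defined]. *)
Definition frac_delta_right h alpha w : int -> R := fun n =>
  (h `^ alpha)^-1 * limn (series (frac_delta_term alpha w n)).

Definition frac_delta_defined alpha w : Prop :=
  forall n : int, cvgn (series (frac_delta_term alpha w n)).

(** Euler's integral for [s > 0], continued to the other reals by
    [Gamma s = Gamma (s + n) / (s (s + 1) ... (s + n - 1))], where [n] is the
    least natural number such that [s + n > 0]; the values at the poles
    [0, -1, -2, ...] are meaningless. *)
Definition Gamma_int s : R :=
  \int[mu]_(t in `]0, +oo[) (t `^ (s - 1) * expR (- t)).

Definition Gamma s : R :=
  if 0 < s then Gamma_int s else
  let n := (Num.truncn (- s)).+1 in
  Gamma_int (s + n%:R) / \prod_(i < n) (s + i%:R).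

Definition marchaud_integrand alpha f x (t : R) : R :=
  (f (x + t) - f x) / t `^ (1 + alpha).

(** The integral is total: the value below is meaningful only under
    [marchaud_defined]. *)
Definition marchaud_right alpha f : R -> R := fun x =>
  (Gamma (- alpha))^-1 *
  \int[mu]_(t in `]0, +oo[) marchaud_integrand alpha f x t.

Definition marchaud_defined alpha f : Prop :=
  forall x, mu.-integrable `]0, +oo[ (EFin \o marchaud_integrand alpha f x).

Definition holder_seminorm beta f : \bar R :=
  ereal_sup [set (`|f p.1 - f p.2| / `|p.1 - p.2| `^ beta)%:E
            | p in [set p : R * R | p.1 != p.2]].

Definition class_C (k : nat) u : Prop :=
  (forall l x, (l < k)%N -> derivable (derive1n l u) x 1) /\
  continuous (derive1n k u).

(** Only the seminorm of the top derivative is required to be finite: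
    elements of the class need not be bounded. *)
Definition holder_class (k : nat) beta u : Prop :=
  class_C k u /\ (holder_seminorm beta (derive1n k u) < +oo)%E.

Definition holder_norm (k : nat) beta u : \bar R :=
  (\sum_(0 <= l < k.+1) 'N[mu]_+oo [EFin \o derive1n l u]
   + holder_seminorm beta (derive1n k u))%E.

Definition linfty_norm w : \bar R := ereal_sup [set (`|w n|)%:E | n in [set: int]].

End Defs.

(* Main.v *)
Require Import Defs.
From HB Require Import structures.
From mathcomp Require Import all_boot all_order all_algebra.
From mathcomp Require Import all_classical all_reals all_analysis.
From mathcomp Require Import measurable_realfun ess_sup_inf.
From mathcomp Require Import ring lra.

(** With [b_j = Gamma (j - alpha) / j!], so that [Gamma (- alpha) * Lambda alpha j
    = b_j] for [j >= 1], Jensen's inequality for the Gamma law gives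
    [b_j = j^(-1-alpha) + O(j^(-2-alpha))]. Hence on the cell
    [jh < t <= (j+1)h] the [j]-th term of the discrete sum, spread uniformly,
    differs from the Marchaud integrand by a multiple of
    [[u] min(t, h)^beta t^(-1-alpha)], whose integral over [t > 0] is
    [O(h^(beta-alpha))]; this is (i).

    For (ii) put [v_e(x) = (u(x + e) - u(x)) / e]. Then
    [- delta_right (delta_right^alpha (r_h u)) = delta_right^alpha (r_h v_h)],
    and by the mean value theorem [v_e] has the same Hölder constant as [u'], so
    (i) applies to [v_h]. The increments of [v_e] and [u'] over [t] differ by at
    most [2 [u'] min(t, |e|)^beta], so [D v_e] is within a multiple of
    [|e|^(beta-alpha)] of [D u']. As [D v_e] is the difference quotient of
    [D u], this proves at once that [(D u)' = D u'] and the remaining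
    estimate. *)

Import Order.TTheory GRing.Theory Num.Theory.
Import numFieldNormedType.Exports.

Set Implicit Arguments.
Unset Strict Implicit.

Local Open Scope classical_set_scope.
Local Open Scope ring_scope.

(** * Integrability of real-valued functions, read through the embedding into the extended reals *)

Section real_integrable.
Context (d : measure_display) (T : measurableType d) (R : realType).
Variables (mu : {measure set T -> \bar R}) (D : set T).
Hypothesis mD : measurable D.
Implicit Types (k : R) (f g : T -> R).

Lemma integrable_scale k f :
  mu.-integrable D (EFin \o f) ->
  mu.-integrable D (EFin \o (fun t => k * f t)).
Proof. by move=> intf; exact: (integrableZl mD k intf). Qed.

Lemma integrable_add f g :
  mu.-integrable D (EFin \o f) -> mu.-integrable D (EFin \o g) ->
  mu.-integrable D (EFin \o (fun t => f t + g t)).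
Proof. by move=> intf intg; exact: (integrableD mD intf intg). Qed.

Lemma integrable_sub f g :
  mu.-integrable D (EFin \o f) -> mu.-integrable D (EFin \o g) ->
  mu.-integrable D (EFin \o (fun t => f t - g t)).
Proof. by move=> intf intg; exact: (integrableB mD intf intg). Qed.

Lemma dominated_integrable_real f g : measurable_fun D f ->
  (forall t, D t -> `|f t| <= g t) ->
  mu.-integrable D (EFin \o g) -> mu.-integrable D (EFin \o f).
Proof.
move=> mf fg; apply: le_integrable => //; first exact/measurable_EFinP.
by move=> t Dt; rewrite lee_fin (le_trans (fg t Dt)) ?ler_norm.
Qed.

End real_integrable.

(** * Integrals over the half-line: exhaustion, powers, and the truncated weight *)

Section half_line_integrals.
Context {R : realType}.
Implicit Types (a b h p t : R) (k : R) (f g F : R -> R) (D : set R) (A : nat -> set R).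
Local Notation mu := (@lebesgue_measure R).

(** Dominated convergence for [f] cut off to [A n], with [|f|] as dominating function. *)
Lemma integral_exhaust_cvg f D A : measurable D ->
    mu.-integrable D (EFin \o f) ->
    (forall n, measurable (A n)) -> (forall n, A n `<=` D) ->
    (forall t, D t -> \forall n \near \oo, A n t) ->
  \int[mu]_(t in A n) f t @[n --> \oo] --> \int[mu]_(t in D) f t.
Proof.
move=> mD intf mA AD covA.
apply: fine_cvg; rewrite fineK; last exact: integrable_fin_num.
rewrite (_ : (fun n => _) =
    (fun n => \int[mu]_(t in D) ((EFin \o f) \_ (A n)) t)%E); last first.
  by apply/funext => n; rewrite -integral_mkcondr setIidr.
have mf := measurable_int _ intf.
apply: (@dominated_cvg _ (measurableTypeR R) R mu D mD
  (fun n => (EFin \o f) \_ (A n)) (EFin \o f) (abse \o (EFin \o f))) => //.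
- move=> n; apply/(measurable_restrict (EFin \o f) (mA n) mD).
  by apply: measurable_funS mf => //; exact: subIsetl.
- move=> t Dt; apply: cvg_near_cst.
  near=> n; rewrite patchE mem_set//.
  by near: n; exact: covA.
- exact: integrable_abse.
- by move=> n t Dt; rewrite patchE; case: ifPn => //= _; rewrite normr0 lee_fin.
Unshelve. all: by end_near. Qed.

(** Monotone convergence. It yields finiteness of an improper integral of a nonnegative function
    from bounds on compact pieces, before integrability is known. *)
Lemma ge0_integral_exhaust_le f D A (M : \bar R) : measurable D ->
    measurable_fun D f -> (forall t, D t -> 0 <= f t) ->
    nondecreasing_seq A -> (forall n, measurable (A n)) ->
    \bigcup_n A n = D ->
    (forall n, \int[mu]_(t in A n) (f t)%:E <= M)%E ->
  (\int[mu]_(t in D) (f t)%:E <= M)%E.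
Proof.
move=> mD mf f0 ndA mA AD le_M.
have AsD n : A n `<=` D by rewrite -AD; exact: bigcup_sup.
have := @ge0_nondecreasing_set_cvg_integral _ (measurableTypeR R) R A (EFin \o f) mu ndA mA.
rewrite AD => cvA; have {}cvA := cvA _ _.
apply: (cvge_le _ (cvA _ _)).
- by apply: nearW => n; exact: le_M.
- by move=> n; apply/measurable_EFinP; exact: measurable_funS (AsD n) mf.
- by move=> n t /AsD Dt; rewrite lee_fin f0.
Qed.

Lemma FTC_pos f F (a b : R) : 0 < a -> a < b ->
    (forall t : R, 0 < t -> is_derive t 1 F (f t)) ->
    (forall t : R, 0 < t -> {for t, continuous f}) ->
  (\int[mu]_(t in `[a, b]) (f t)%:E = (F b - F a)%:E)%E.
Proof.
move=> a0 ab dF cf.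
have cF t : 0 < t -> {for t, continuous F}.
  by move=> t0; apply/differentiable_continuous/derivable1_diffP; case: (dF t t0).
rewrite EFinB; apply: continuous_FTC2 => //.
- apply: continuous_in_subspaceT => x /set_mem/=; rewrite in_itv/= => /andP[ax _].
  exact/cf/(lt_le_trans a0).
- split.
  + by move=> x; rewrite in_itv/= => /andP[/(lt_trans a0)/dF[]].
  + exact/cvg_at_right_filter/cF.
  + exact/cvg_at_left_filter/cF/(lt_trans a0).
- move=> x; rewrite in_itv/= => /andP[/(lt_trans a0)/dF dFx _].
  by rewrite derive1E; exact: derive_val.
Qed.

Lemma continuous_powR (p t : R) : 0 < t -> {for t, continuous (@powR R ^~ p)}.
Proof.
move=> t0; apply/differentiable_continuous/derivable1_diffP.
by apply: derivable_powR; rewrite in_itv/= t0.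
Qed.

Lemma integral_powR (p a b : R) : p != 0 -> 0 < a -> a < b ->
  (\int[mu]_(t in `[a, b]) (t `^ (p - 1))%:E = ((b `^ p - a `^ p) / p)%:E)%E.
Proof.
move=> p0 a0 ab.
have := @FTC_pos (fun t => t `^ (p - 1)) (fun t => p^-1 * t `^ p) _ _ a0 ab.
rewrite -mulrBr [p^-1 * _]mulrC; apply.
- move=> t t0; have dp := is_derive1_powR p t0.
  apply: (is_derive_eq (is_deriveZ p^-1 dp)).
  by rewrite /GRing.scale/= mulrA mulVf// mul1r.
- by move=> t; exact: continuous_powR.
Qed.

(** On [[h/(n+2), h]] the primitive [t^p / p] gives the value, and its term at the lower endpoint is
    dropped. *)
Lemma integral_powR_near0_le (p h : R) : 0 < p -> 0 < h ->
  (\int[mu]_(t in `]0%R, h]) (t `^ (p - 1))%:E <= (h `^ p / p)%:E)%E.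
Proof.
move=> p0 h0.
(* The shift by 2 keeps the interval nondegenerate already at [n = 0]. *)
have le_div n : h / n.+2%:R < h.
  by rewrite ltr_pdivrMr// ltr_pMr// ltr1n.
apply: (@ge0_integral_exhaust_le _ _ (fun n => `[h / n.+2%:R, h]%classic)) => //.
- by apply: measurable_funS (measurable_powR (p - 1)).
- by move=> t _; exact: powR_ge0.
- apply/nondecreasing_seqP => n; rewrite subsetEset.
  apply: subset_itvr; rewrite bnd_simp ler_pM2l// lef_pV2 ?posrE//.
  by rewrite ler_nat.
- apply/seteqP; split=> [t [n _]|t]/=; rewrite !in_itv/=.
    by case/andP => ht ->; rewrite (lt_le_trans _ ht)// divr_gt0.
  case/andP=> t0 th; exists (Num.truncn (h / t)) => //=.
  rewrite in_itv/= th andbT ler_pdivrMr// mulrC -ler_pdivrMr//.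
  by rewrite ltW// (lt_trans (truncnS_gt _))// ltr_nat.
- move=> n; rewrite integral_powR ?gt_eqF// ?divr_gt0// lee_fin.
  by rewrite ler_pM2r ?invr_gt0// gerBl powR_ge0.
Qed.

Lemma integral_powR_tail_le (a h : R) : 0 < a -> 0 < h ->
  (\int[mu]_(t in `]h, +oo[) (t `^ (- a - 1))%:E <= (h `^ (- a) / a)%:E)%E.
Proof.
move=> a0 h0; rewrite integral_itv_obnd_cbnd; last first.
  by apply/measurable_EFinP; apply: measurable_funS (measurable_powR _).
apply: (@ge0_integral_exhaust_le _ _ (fun n => `[h, h + n.+1%:R]%classic)) => //.
- by apply: measurable_funS (measurable_powR _).
- by move=> t _; exact: powR_ge0.
- apply/nondecreasing_seqP => n; rewrite subsetEset.
  by apply: subset_itvl; rewrite bnd_simp lerD2l ler_nat.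
- apply/seteqP; split=> [t [n _]|t]/=; rewrite !in_itv/=.
    by case/andP => ->.
  rewrite andbT => ht; exists (Num.truncn (t - h)) => //=.
  by rewrite in_itv/= ht/= -lerBlDl ltW// truncnS_gt.
- move=> n; rewrite integral_powR ?oppr_eq0 ?gt_eqF// ?ltrDl// lee_fin.
  rewrite invrN mulrN -mulNr opprB ler_pM2r ?invr_gt0// gerBl.
  exact: powR_ge0.
Qed.

(* Every error term below is dominated by a multiple of this weight, whose
   integral over the half-line is [O(h^(b-a))]. *)
Definition trunc_weight (a b h t : R) : R := Num.min t h `^ b / t `^ (1 + a).

Lemma trunc_weight_ge0 a b h t : 0 <= trunc_weight a b h t.
Proof. by rewrite divr_ge0// powR_ge0. Qed.

Lemma trunc_weight_near0 a b h t : 0 < t -> t <= h ->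
  trunc_weight a b h t = t `^ (b - a - 1).
Proof.
move=> t0 th; rewrite /trunc_weight min_l// -powRB; last first.
  by apply/implyP => _; rewrite gt_eqF.
by congr (_ `^ _); ring.
Qed.

Lemma trunc_weight_tail a b h t : h <= t ->
  trunc_weight a b h t = h `^ b * t `^ (- a - 1).
Proof.
move=> ht; rewrite /trunc_weight min_r// -powRN.
by congr (_ * _ `^ _); ring.
Qed.

Lemma measurable_trunc_weight a b h D : measurable D ->
  measurable_fun D (trunc_weight a b h).
Proof.
move=> mD; apply: measurable_funS (@subsetT _ D) _ => //.
apply: measurable_funM.
- apply: (measurableT_comp (measurable_powR b)).
  by apply: measurable_minr => //; exact: measurable_cst.
- under eq_fun do rewrite -powRN.
  exact: measurable_powR.
Qed.

(** Split at [h]: the weight is [t^(b-a-1)] up to [h] and [h^b t^(-a-1)] beyond, and the two pieces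
    contribute the two summands of the constant. *)
Lemma integral_trunc_weight_le a b h : 0 < a -> a < b -> 0 < h ->
  (\int[mu]_(t in `]0%R, +oo[) (trunc_weight a b h t)%:E
    <= (((b - a)^-1 + a^-1) * h `^ (b - a))%:E)%E.
Proof.
move=> a0 ab h0.
rewrite (_ : `]0, +oo[%classic = `]0, h] `|` `]h, +oo[); last first.
  by rewrite -itv_bndbnd_setU ?bnd_simp// ltW.
rewrite ge0_integral_setU//=; last 3 first.
- by apply/measurable_EFinP; apply: measurable_trunc_weight; exact: measurableU.
- by move=> t _; rewrite lee_fin trunc_weight_ge0.
- apply/disj_setPLR => t/=; rewrite !in_itv/= => /andP[_ th].
  by apply/negP; rewrite andbT -leNgt.
rewrite mulrDl EFinD. apply: leeD.
- rewrite [leLHS](_ : _ = \int[mu]_(t in `]0%R, h]) (t `^ (b - a - 1))%:E)%E.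
    by rewrite mulrC; apply: integral_powR_near0_le => //; rewrite subr_gt0.
  apply: eq_integral => t /set_mem/=; rewrite in_itv/= => /andP[t0 th].
  by rewrite trunc_weight_near0.
- rewrite [leLHS](_ : _ =
      \int[mu]_(t in `]h, +oo[) ((h `^ b)%:E * (t `^ (- a - 1))%:E))%E.
    rewrite ge0_integralZl_EFin//; last 3 first.
    + by move=> t _; rewrite lee_fin powR_ge0.
    + by apply/measurable_EFinP; apply: measurable_funS (measurable_powR _).
    + exact: powR_ge0.
    rewrite (_ : a^-1 * _ = h `^ b * (h `^ (- a) / a)); last first.
      rewrite powRD; first by ring.
      by apply/implyP => _; rewrite gt_eqF.
    rewrite EFinM lee_pmul2l ?lte_fin ?powR_gt0//.
    exact: integral_powR_tail_le.
  apply: eq_integral => t /set_mem/=; rewrite in_itv/= andbT => /ltW ht.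
  by rewrite trunc_weight_tail.
Qed.

Lemma integrable_trunc_weight a b h : 0 < a -> a < b -> 0 < h ->
  mu.-integrable `]0, +oo[ (EFin \o trunc_weight a b h).
Proof.
move=> a0 ab h0; apply/integrableP; split.
  by apply/measurable_EFinP; exact: measurable_trunc_weight.
under eq_integral => t _ do rewrite /= ger0_norm ?trunc_weight_ge0//.
by apply: le_lt_trans (integral_trunc_weight_le _ _ _) _ => //; exact: ltry.
Qed.

Lemma Rintegral_trunc_weight_le a b h : 0 < a -> a < b -> 0 < h ->
  \int[mu]_(t in `]0, +oo[) trunc_weight a b h t
    <= ((b - a)^-1 + a^-1) * h `^ (b - a).
Proof.
move=> a0 ab h0; rewrite -lee_fin fineK ?integral_trunc_weight_le//.
by apply: integrable_fin_num => //; exact: integrable_trunc_weight.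
Qed.

(** The fundamental theorem on [[1/(n+2), n+2]], followed by the limit in [n]; integrability of [f]
    identifies the limit with the integral. *)
Lemma Rintegral_pos_FTC f F (l0 l1 : R) :
    mu.-integrable `]0, +oo[ (EFin \o f) ->
    (forall t : R, 0 < t -> is_derive t 1 F (f t)) ->
    (forall t : R, 0 < t -> {for t, continuous f}) ->
    F t @[t --> 0^'+] --> l0 -> F t @[t --> +oo] --> l1 ->
  \int[mu]_(t in `]0, +oo[) f t = l1 - l0.
Proof.
move=> intf dF cf Fl0 Fl1.
pose A n : set R := `[n.+2%:R^-1, n.+2%:R]%classic.
have A0 n : 0 < n.+2%:R^-1 :> R by rewrite invr_gt0.
have A1 n : n.+2%:R^-1 < n.+2%:R :> R.
  by rewrite (@lt_trans _ _ 1)// ?invf_lt1// ltr1n.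
have cvA : \int[mu]_(t in A n) f t @[n --> \oo] --> \int[mu]_(t in `]0, +oo[) f t.
  apply: integral_exhaust_cvg => //.
  - by move=> n; exact: measurable_itv.
  - move=> n t /=; rewrite !in_itv/= andbT => /andP[nt _].
    exact: lt_le_trans (A0 n) nt.
  - move=> t /=; rewrite in_itv/= andbT => t0.
    (* The sum [t + 1/t] dominates both [t] and [1/t], so one threshold serves both ends. *)
    exists (Num.truncn (t + t^-1)) => // n /= tn.
    have tn1 : t + t^-1 <= n.+2%:R.
      by rewrite ltW// (lt_trans (truncnS_gt _))// ltr_nat ltnS.
    have ti : 0 < t^-1 by rewrite invr_gt0.
    rewrite /A/= in_itv/= -[X in _ <= X <= _]invrK lef_pV2 ?posrE ?invr_gt0//.
    rewrite invrK.
    by apply/andP; split; lra.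
suff cvF : \int[mu]_(t in A n) f t @[n --> \oo] --> l1 - l0.
  by apply: (cvg_unique _ cvA cvF).
rewrite (_ : (fun n => _) = (fun n => F n.+2%:R - F n.+2%:R^-1)).
  apply: cvgB.
  - apply: (cvg_pinftyP F l1).1 => //.
    apply/cvgryPge => M; near=> n.
    rewrite ltW// (lt_trans (truncnS_gt _))// ltr_nat ltnS.
    by near: n; exact: nbhs_infty_ge.
  - apply: (cvg_at_rightP F 0 l0).1 => //; split => //.
    apply/gtr0_cvgV0; first by apply: nearW.
    apply/cvgryPge => M; near=> n.
    rewrite ltW// (lt_trans (truncnS_gt _))// ltr_nat ltnS.
    by near: n; exact: nbhs_infty_ge.
apply/funext => n.
by rewrite /Rintegral (FTC_pos (A0 n) (A1 n) dF cf).
Unshelve. all: by end_near. Qed.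

End half_line_integrals.

(** * Euler's integral, its recurrence, and the size of the weights b_j *)

Section gamma_function.
Context {R : realType}.
Implicit Types (a b h p s t : R).
Local Notation mu := (@lebesgue_measure R).

(** The inequality [t/p <= exp(t/p)] raised to the power [p]. *)
Lemma powR_le_expR p t : 0 < p -> 0 <= t -> t `^ p <= p `^ p * expR t.
Proof.
move=> p0 t0.
have tp : t / p <= expR (t / p).
  by apply: le_trans (expR_ge1Dx _); rewrite lerDr.
have -> : t `^ p = p `^ p * (t / p) `^ p.
  by rewrite -powRM ?divr_ge0 ?(ltW p0)// mulrC divfK// gt_eqF.
rewrite ler_pM2l ?powR_gt0//.
rewrite -[in leRHS](@divfK _ p _ t) ?gt_eqF// expRM.
by apply: ge0_ler_powR => //; rewrite ?nnegrE ?divr_ge0 ?expR_ge0// ltW.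
Qed.

Lemma powR_expRN_cvg0 p : 0 < p -> t `^ p * expR (- t) @[t --> +oo] --> 0.
Proof.
move=> p0.
apply: (@squeeze_cvgr _ _ _ _ (cst 0) (fun t => (p + 1) `^ (p + 1) * t^-1)).
- near=> t.
  have t0 : 0 < t by near: t; exact: nbhs_pinfty_gt.
  rewrite mulr_ge0 ?powR_ge0 ?expR_ge0//= expRN ler_pdivrMr ?expR_gt0//.
  rewrite mulrAC ler_pdivlMr//.
  have -> : t `^ p * t = t `^ (p + 1).
    rewrite powRD ?powRr1 ?ltW//.
    by apply/implyP => _; rewrite gt_eqF.
  by apply: powR_le_expR; rewrite ?ltW// ltr_wpDl// ltW.
- exact: cvg_cst.
- rewrite -[X in _ --> X](mulr0 ((p + 1) `^ (p + 1))).
  apply: cvgMr; apply/gtr0_cvgV0.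
    by near=> t; near: t; exact: nbhs_pinfty_gt.
  exact: cvg_id.
Unshelve. all: by end_near. Qed.

Definition gamma_integrand s t : R := t `^ (s - 1) * expR (- t).

Lemma gamma_integrand_ge0 s t : 0 <= gamma_integrand s t.
Proof. by rewrite mulr_ge0 ?powR_ge0 ?expR_ge0. Qed.

Lemma measurable_gamma_integrand s (D : set R) : measurable D ->
  measurable_fun D (gamma_integrand s).
Proof.
move=> mD; apply: measurable_funS (@subsetT _ D) _ => //.
apply: measurable_funM; first exact: measurable_powR.
by apply: measurableT_comp => //; exact: measurable_funN.
Qed.

(** With parameters [1], [s + 1], [1] the weight is [t^(s-1)] on []0, 1]] and [t^(-2)] beyond, so
    its integrability carries over to Euler's integral. *)
Lemma gamma_integrand_le s t : 0 < s -> 0 < t ->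
  gamma_integrand s t
    <= (1 + (s + 1) `^ (s + 1)) * trunc_weight 1 (s + 1) 1 t.
Proof.
move=> s0 t0; set p := s + 1; rewrite /gamma_integrand.
have p0 : 0 < p by rewrite /p addr_gt0.
have pp0 := powR_ge0 p p.
have [t1|/ltW t1] := leP t 1.
- rewrite trunc_weight_near0// (_ : p - 1 - 1 = s - 1); last by rewrite /p; ring.
  rewrite mulrC ler_wpM2r ?powR_ge0//.
  by apply: (@le_trans _ _ 1); rewrite ?lerDl// expR_le1 oppr_le0 ltW.
- rewrite trunc_weight_tail// powR1 mul1r.
  have -> : t `^ (s - 1) = t `^ p * t `^ (- 1 - 1).
    rewrite -powRD; first by congr powR; rewrite /p; ring.
    by apply/implyP => _; rewrite gt_eqF.
  rewrite mulrAC ler_wpM2r ?powR_ge0// expRN ler_pdivrMr ?expR_gt0//.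
  apply: le_trans (powR_le_expR p0 (ltW t0)) _.
  by rewrite ler_wpM2r ?expR_ge0// lerDr.
Qed.

Lemma integrable_gamma_integrand s : 0 < s ->
  mu.-integrable `]0, +oo[ (EFin \o gamma_integrand s).
Proof.
move=> s0.
have := @integrable_trunc_weight R 1 (s + 1) 1 ltr01 _ ltr01.
rewrite ltrDr => /(_ s0) iE.
apply: (@dominated_integrable_real _ (measurableTypeR R) R mu _ _
    (gamma_integrand s) (fun t =>
    (1 + (s + 1) `^ (s + 1)) * trunc_weight 1 (s + 1) 1 t)) => //.
- exact: measurable_gamma_integrand.
- move=> t /=; rewrite in_itv/= andbT => t0.
  by rewrite ger0_norm ?gamma_integrand_ge0 ?gamma_integrand_le.
- exact: integrable_scale.
Qed.

Lemma Gamma_intE s :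
  Gamma_int s = \int[mu]_(t in `]0, +oo[) gamma_integrand s t.
Proof. by []. Qed.

Lemma Gamma_int_ge0 s : 0 <= Gamma_int s.
Proof. by apply: Rintegral_ge0 => t _; exact: gamma_integrand_ge0. Qed.

Lemma continuous_expRN t : {for t, continuous (fun t => expR (- t) : R)}.
Proof.
by apply: continuous_comp; [exact: continuousN | exact: continuous_expR].
Qed.

Lemma continuous_gamma_integrand s t : 0 < t ->
  {for t, continuous (gamma_integrand s)}.
Proof.
move=> t0; apply: continuousM; first exact: continuous_powR.
exact: continuous_expRN.
Qed.

Lemma is_derive_expRN t : is_derive t 1 (fun t => expR (- t) : R) (- expR (- t)).
Proof.
have := @is_derive1_comp R expR -%R t (expR (- t)) (- 1) _ _.
by rewrite mulrN1; apply.
Qed.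

Lemma Gamma_int1 : Gamma_int 1 = 1 :> R.
Proof.
rewrite -[RHS]opprK -[RHS]sub0r Gamma_intE.
apply: (@Rintegral_pos_FTC _ _ (fun t => - expR (- t)) (- 1) 0).
- exact: integrable_gamma_integrand.
- move=> t t0; rewrite /gamma_integrand subrr powRr0 mul1r.
  by rewrite -[expR _]opprK; apply: is_deriveN; exact: is_derive_expRN.
- by move=> t; exact: continuous_gamma_integrand.
- apply: cvg_at_right_filter; apply: cvgN.
  have -> : (1 : R) = expR (- 0) by rewrite oppr0 expR0.
  exact: continuous_expRN.
- by rewrite -oppr0; apply: cvgN; exact: cvgr_expR.
Qed.

(** Integration by parts: the difference of the two integrands is the derivative of [t^s exp(-t)],
    which vanishes at both ends. *)
Lemma Gamma_intD1 s : 0 < s -> Gamma_int (s + 1) = s * Gamma_int s.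
Proof.
move=> s0; apply/eqP; rewrite eq_sym -subr_eq0; apply/eqP.
have s1 : 0 < s + 1 by rewrite addr_gt0.
have is0 := integrable_gamma_integrand s0.
have is1 := integrable_gamma_integrand s1.
have iss0 : mu.-integrable `]0, +oo[ (EFin \o (fun t => s * gamma_integrand s t)).
  exact: integrable_scale.
rewrite !Gamma_intE -RintegralZl// -RintegralB//.
rewrite -[RHS]subr0.
apply: (@Rintegral_pos_FTC _ _ (fun t => t `^ s * expR (- t)) 0 0).
- exact: integrable_sub.
- move=> t t0.
  apply: (is_derive_eq (is_deriveM (is_derive1_powR s t0) (is_derive_expRN t))).
  rewrite /gamma_integrand /GRing.scale/= (_ : s + 1 - 1 = s); last by ring.
  by ring.
- move=> t t0; apply: continuousB; last exact: continuous_gamma_integrand.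
  apply: continuousM; first exact: cst_continuous.
  exact: continuous_gamma_integrand.
- have := cvgM (powR_cvg0 s0) (cvg_at_right_filter (@continuous_expRN 0)).
  by rewrite mul0r => cv; exact: cv.
- exact: powR_expRN_cvg0.
Qed.

Lemma Gamma_int_nat n : Gamma_int n.+1%:R = n`!%:R :> R.
Proof.
elim: n => [|n IHn]; first exact: Gamma_int1.
by rewrite -natr1 Gamma_intD1// IHn factS natrM.
Qed.

(** Convexity, as the tangent at [t = 1]; it follows from [exp y >= 1 + y] and [ln t <= t - 1]. *)
Lemma powRN_ge_tangent a t : 0 < a -> 0 < t -> 1 - a * (t - 1) <= t `^ (- a).
Proof.
move=> a0 t0; rewrite /powR gt_eqF//.
apply: le_trans (expR_ge1Dx _); rewrite mulNr lerD2l lerN2 ler_pM2l//.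
have := @le_ln1Dx R (t - 1); rewrite [1 + _]addrC subrK; apply.
by rewrite ltrBrDl addrN.
Qed.

(* Jensen's inequality for the convex function [t^(-a)] and the Gamma law of
   parameter [s], whose mean is [s]. *)
Lemma Gamma_int_shift_ge s a : 0 < a -> a < s ->
  s `^ (- a) * Gamma_int s <= Gamma_int (s - a).
Proof.
move=> a0 as0; have s0 := lt_trans a0 as0.
have sa0 : 0 < s - a by rewrite subr_gt0.
have s1 : 0 < s + 1 by rewrite addr_gt0.
have is0 := integrable_gamma_integrand s0.
have is1 := integrable_gamma_integrand s1.
(* The right side integrates the tangent [1 - a (t/s - 1)] against the Gamma density; its linear
   part has mean zero, by the recurrence. What remains is a pointwise tangent inequality at
   [t/s]. *)
have -> : s `^ (- a) * Gamma_int s = s `^ (- a) *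
    ((1 + a) * Gamma_int s - a / s * Gamma_int (s + 1)).
  by rewrite Gamma_intD1//; field; rewrite gt_eqF.
have iz (r p : R) : 0 < p ->
    mu.-integrable `]0, +oo[ (EFin \o (fun t => r * gamma_integrand p t)).
  by move=> /integrable_gamma_integrand; exact: integrable_scale.
have iB : mu.-integrable `]0, +oo[ (EFin \o (fun t =>
    (1 + a) * gamma_integrand s t - a / s * gamma_integrand (s + 1) t)).
  by apply: integrable_sub => //; exact: iz.
rewrite !Gamma_intE -!RintegralZl// -RintegralB//; [|exact: iz|exact: iz].
rewrite -RintegralZl//.
apply: le_Rintegral => //.
- exact: integrable_scale.
- exact: integrable_gamma_integrand.
move=> t /=; rewrite in_itv/= andbT => t0.
rewrite /gamma_integrand.
have tn0 : t != 0 by rewrite gt_eqF.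
have -> : t `^ (s + 1 - 1) = t `^ (s - 1) * t.
  rewrite -[X in _ * X](@powRr1 R) ?ltW// -powRD ?tn0 ?implybT//.
  by congr powR; ring.
have -> : t `^ (s - a - 1) = t `^ (s - 1) * t `^ (- a).
  by rewrite -powRD ?tn0 ?implybT//; congr powR; ring.
have -> : t `^ (- a) = s `^ (- a) * (t / s) `^ (- a).
  by rewrite -powRM ?divr_ge0 ?ltW// mulrC divfK// gt_eqF.
have -> : s `^ (- a) * ((1 + a) * (t `^ (s - 1) * expR (- t)) -
    a / s * (t `^ (s - 1) * t * expR (- t))) =
    (s `^ (- a) * t `^ (s - 1) * expR (- t)) * (1 - a * (t / s - 1)) by ring.
have -> : t `^ (s - 1) * (s `^ (- a) * (t / s) `^ (- a)) * expR (- t) =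
    (s `^ (- a) * t `^ (s - 1) * expR (- t)) * (t / s) `^ (- a) by ring.
rewrite ler_wpM2l ?mulr_ge0 ?powR_ge0 ?expR_ge0//.
by rewrite powRN_ge_tangent// divr_gt0.
Qed.

(** For [0 < a < 1] the continuation takes exactly one step, since [truncn a = 0]. *)
Lemma Gamma_oppr a : 0 < a -> a < 1 -> Gamma (- a) = - (Gamma_int (1 - a) / a).
Proof.
move=> a0 a1; rewrite /Gamma oppr_gt0 ltNge (ltW a0)/= opprK.
have -> : Num.truncn a = 0%N by apply/truncn_def; rewrite ltW.
by rewrite big_ord1 addr0 addrC invrN mulrN.
Qed.

Definition gamma_ratio a (j : nat) : R := Gamma_int (j%:R - a) / j`!%:R.

Lemma gamma_ratio_ge0 a j : 0 <= gamma_ratio a j.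
Proof. by rewrite divr_ge0// Gamma_int_ge0. Qed.

Lemma gamma_ratioS a j : a < j%:R ->
  gamma_ratio a j.+1 * j.+1%:R = gamma_ratio a j * (j%:R - a).
Proof.
move=> aj; rewrite /gamma_ratio.
have -> : j.+1%:R - a = (j%:R - a) + 1 by rewrite -natr1; ring.
rewrite Gamma_intD1 ?subr_gt0// factS natrM.
by field; rewrite nat1r !pnatr_eq0 -lt0n fact_gt0.
Qed.

Lemma LambdaS a m : Lambda a m.+1 * m.+1%:R = Lambda a m * (m%:R - a).
Proof.
rewrite !LambdaE /gbinom big_ord_recr/= factS natrM exprS.
by field; rewrite nat1r !pnatr_eq0 -lt0n fact_gt0.
Qed.

(** Both sides obey the same first-order recurrence ([LambdaS], [gamma_ratioS]). They agree at index
    1, where [Lambda a 1 = - a] cancels the denominator of [Gamma (- a)]. *)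
Lemma Lambda_gamma_ratio a m : 0 < a -> a < 1 ->
  Gamma (- a) * Lambda a m.+1 = gamma_ratio a m.+1.
Proof.
move=> a0 a1; elim: m => [|m IHm].
  rewrite Gamma_oppr// LambdaE /gbinom /gamma_ratio big_ord1/= (_ : 1`! = 1%N)//.
  by field; rewrite gt_eqF.
apply: (@mulIf _ m.+2%:R); first by rewrite pnatr_eq0.
rewrite -mulrA LambdaS gamma_ratioS.
  by rewrite mulrA IHm.
by rewrite (lt_le_trans a1)// ler1n.
Qed.

(** With [j = m + 2], Jensen's inequality is used twice: from [j] down by [a] for the lower bound,
    and from [j - a] down by [1 - a] to [j - 1] for the upper one. The second needs [j > 1]. *)
Lemma gamma_ratio_bounds a m : 0 < a -> a < 1 ->
  0 <= gamma_ratio a m.+2 - m.+2%:R `^ (- (1 + a))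
    <= 2 * m.+2%:R `^ (- (2 + a)).
Proof.
move=> a0 a1; set j := m.+2; pose r : R := j%:R.
have r0 : 0 < r by rewrite /r ltr0n.
have rm : r = m.+1%:R + 1 by rewrite /r /j -[in LHS]natr1.
have r1 : 0 < r - 1 by rewrite rm addrK.
have rn0 : r != 0 by rewrite gt_eqF.
have jf : j`!%:R = r * (r - 1) * m`!%:R :> R.
  by rewrite /j !factS !natrM -/j -/r rm addrK mulrA.
have mf : 0 < m`!%:R :> R by rewrite ltr0n fact_gt0.
have P1 : r `^ (- (1 + a)) = r `^ (- a) / r.
  rewrite -[X in _ / X](@powRr1 R) ?ltW// -powRN -powRD ?rn0 ?implybT//.
  by congr powR; ring.
have P2 : r `^ (- (2 + a)) = r `^ (- a) / r ^+ 2.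
  rewrite -[X in _ / X]powR_mulrn ?ltW// -powRN -powRD ?rn0 ?implybT//.
  by congr powR; ring.
have p0 : 0 < r `^ (- a) by rewrite powR_gt0.
have lo : r `^ (- a) * ((r - 1) * m`!%:R) <= Gamma_int (r - a).
  have -> : (r - 1) * m`!%:R = Gamma_int r.
    by rewrite {2}/r Gamma_int_nat factS natrM rm addrK.
  by apply: Gamma_int_shift_ge; rewrite // rm ltr_wpDl.
have hi : Gamma_int (r - a) <= r `^ (- a) * r * m`!%:R.
  have ra : 0 < r - a by rewrite subr_gt0 rm ltr_wpDl.
  have := @Gamma_int_shift_ge (r - a) (1 - a).
  rewrite subr_gt0 => /(_ a1); rewrite ltrD2r.
  have -> : r - a - (1 - a) = m.+1%:R by rewrite rm; ring.
  have r1' : 1 < r by rewrite rm ltrDr.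
  rewrite Gamma_int_nat powRN => /(_ r1').
  rewrite mulrC ler_pdivrMr ?powR_gt0// => /le_trans; apply.
  rewrite mulrC ler_wpM2r ?(ltW mf)//.
  have -> : r `^ (- a) * r = r `^ (1 - a).
    rewrite -[X in _ * X](@powRr1 R) ?ltW// -powRD ?rn0 ?implybT//.
    by congr powR; ring.
  by apply: ge0_ler_powR; rewrite ?nnegrE ?(ltW ra) ?(ltW r0) ?gerBl ?(ltW a0)//
    subr_ge0 ltW.
rewrite -/r P1 P2 /gamma_ratio -/r jf.
have d0 : 0 < r * (r - 1) * m`!%:R by rewrite !mulr_gt0.
have rm1 : 1 <= r - 1 by rewrite rm addrK ler1n.
apply/andP; split.
- rewrite subr_ge0 ler_pdivlMr//.
  by have -> : r `^ (- a) / r * (r * (r - 1) * m`!%:R) =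
    r `^ (- a) * ((r - 1) * m`!%:R) by field.
- rewrite lerBlDr ler_pdivrMr//; apply: le_trans hi _.
  have -> : (2 * (r `^ (- a) / r ^+ 2) + r `^ (- a) / r) *
      (r * (r - 1) * m`!%:R) =
      r `^ (- a) * m`!%:R * ((2 / r + 1) * (r - 1)) by field.
  have -> : r `^ (- a) * r * m`!%:R = r `^ (- a) * m`!%:R * r by ring.
  rewrite ler_pM2l ?mulr_gt0//.
  (* The upper bound amounts to [1/(r-1) <= 1/r + 2/r^2], which is where [r >= 2] enters. *)
  have -> : (2 / r + 1) * (r - 1) = r + (r - 2) / r by field.
  by rewrite lerDl divr_ge0 ?(ltW r0)//; lra.
Qed.

(* The factor [8] bounds [2^(2+a)], the cost of replacing [j] by any point of
   [[j, j+1]] in [j^(-2-a)]. *)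
Definition ratio_const a : R := 8 * (4 + a + Gamma_int (1 - a)).

Lemma ratio_const_ge0 a : 0 < a -> 0 <= ratio_const a.
Proof.
by move=> a0; rewrite mulr_ge0// addr_ge0 ?Gamma_int_ge0// addr_ge0// ltW.
Qed.

Lemma powRN2_split a r : 0 < r ->
  r `^ (- (1 + a)) = r `^ (- (2 + a)) * r.
Proof.
move=> r0; rewrite -[X in _ * X](@powRr1 R) ?ltW// -powRD.
  by congr powR; ring.
by apply/implyP => _; rewrite gt_eqF.
Qed.

(** Two comparisons: b_j with the power at the left endpoint [r], then the power at [r] with the
    power at [x] by the tangent inequality at [x/r]. The point [x] will be [t/h]. *)
Lemma gamma_ratio_sub_powR_le a m (x : R) : 0 < a -> a < 1 ->
    m.+1%:R <= x <= m.+2%:R ->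
  `|gamma_ratio a m.+1 - x `^ (- (1 + a))|
    <= ratio_const a * x `^ (- (2 + a)).
Proof.
move=> a0 a1 /andP[mx xm]; set r : R := m.+1%:R in mx *.
have r1 : 1 <= r by rewrite /r ler1n.
have r0 : 0 < r by exact: lt_le_trans r1.
have x0 : 0 < x by exact: lt_le_trans mx.
have xr : x <= r + 1 by rewrite natr1.
have G0 := @Gamma_int_ge0 (1 - a).
set G := Gamma_int (1 - a) in G0 *.
set P := r `^ (- (2 + a)).
have P0 : 0 < P by rewrite powR_gt0.
have near_r : `|gamma_ratio a m.+1 - r `^ (- (1 + a))| <= (3 + G) * P.
  case: m @r mx xm r1 r0 xr @P P0 => [|m] r mx xm r1 r0 xr P P0.
    (* The index 1 lies outside [gamma_ratio_bounds]; there the difference is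
       [Gamma_int (1 - a) - 1], which explains the summand [G]. *)
    rewrite /P /r /gamma_ratio !powR1 (_ : 1`! = 1%N)// divr1 mulr1 -/G.
    by rewrite ler_norml; apply/andP; split; lra.
  have /andP[lo hi] := gamma_ratio_bounds m a0 a1.
  rewrite ger0_norm//; apply: le_trans hi _.
  by rewrite ler_pM2r//; lra.
have pow_r : `|r `^ (- (1 + a)) - x `^ (- (1 + a))| <= (1 + a) * P.
  have xrE : x `^ (- (1 + a)) = r `^ (- (1 + a)) * (x / r) `^ (- (1 + a)).
    by rewrite -powRM ?divr_ge0 ?(ltW r0) ?(ltW x0)// mulrC divfK// gt_eqF.
  rewrite ger0_norm; last first.
    rewrite subr_ge0 !powRN lef_pV2 ?posrE ?powR_gt0//.
    by apply: ge0_ler_powR; rewrite ?nnegrE ?(ltW r0) ?(ltW x0)// addr_ge0// ltW.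
  have a10 : 0 < 1 + a by rewrite addr_gt0.
  have := powRN_ge_tangent a10 (divr_gt0 x0 r0).
  rewrite xrE => tg.
  have -> : r `^ (- (1 + a)) = P * r by exact: powRN2_split.
  have -> (y : R) : P * r - P * r * y = P * r * (1 - y) by ring.
  have step : 1 - (x / r) `^ (- (1 + a)) <= (1 + a) * (x / r - 1).
    by rewrite lerBlDr -lerBlDl.
  apply: (@le_trans _ _ (P * r * ((1 + a) * (x / r - 1)))).
    by rewrite ler_pM2l// mulr_gt0.
  have -> : P * r * ((1 + a) * (x / r - 1)) = (1 + a) * P * (x - r).
    by field; rewrite gt_eqF.
  by rewrite ler_piMr ?mulr_ge0 ?(ltW a10) ?(ltW P0)//; lra.
(* Since [r >= 1], [x <= r + 1 <= 2 r]; the factor [2^(2+a)] is then at most [2^3]. *)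
have Px : P <= 8 * x `^ (- (2 + a)).
  have x2r : x <= 2 * r by lra.
  have -> : P = 2 `^ (2 + a) * (2 * r) `^ (- (2 + a)).
    rewrite powRM ?(ltW r0)// mulrA -powRD; last by apply/implyP.
    by rewrite addrN powRr0 mul1r.
  apply: ler_pM; rewrite ?powR_ge0//.
    have -> : 8 = 2 `^ 3%:R :> R by rewrite powR_mulrn//; ring.
    by apply: ler_powR; rewrite ?ler1n//; lra.
  rewrite !powRN lef_pV2 ?posrE ?powR_gt0 ?mulr_gt0//.
  by apply: ge0_ler_powR; rewrite ?nnegrE ?mulr_ge0 ?(ltW r0) ?(ltW x0)// addr_ge0// ltW.
have -> : gamma_ratio a m.+1 - x `^ (- (1 + a)) =
  (gamma_ratio a m.+1 - r `^ (- (1 + a))) + (r `^ (- (1 + a)) - x `^ (- (1 + a))) by ring.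
apply: le_trans (ler_normD _ _) _.
apply: le_trans (lerD near_r pow_r) _.
have -> : ratio_const a * x `^ (- (2 + a)) =
  (4 + a + G) * (8 * x `^ (- (2 + a))) by rewrite /ratio_const -/G; ring.
have -> : (3 + G) * P + (1 + a) * P = (4 + a + G) * P by ring.
by rewrite ler_wpM2l// addr_ge0// addr_ge0// ltW.
Qed.

End gamma_function.

(** * Comparison of a series with an integral, cell by cell *)

Section cells.
Context {R : realType}.
Implicit Types (h t : R) (c : nat -> R) (F E G : R -> R).
Local Notation mu := (@lebesgue_measure R).

Let subset_oc_pos (x y : R) : 0 <= x ->
  `]x, y]%classic `<=` `]0, +oo[%classic.
Proof.
move=> x0 t /=; rewrite !in_itv/= andbT => /andP[xt _].
exact: le_lt_trans xt.
Qed.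

(** Induction on the number of cells: [h * c N] is the integral of the constant [c N] over a cell of
    length [h], so the pointwise bound can be integrated there. *)
Lemma sum_cells_sub_integral_le h c F E N : 0 < h ->
    mu.-integrable `]0, +oo[ (EFin \o F) ->
    mu.-integrable `]0, +oo[ (EFin \o E) ->
    (forall (j : nat) t, j%:R * h < t <= j.+1%:R * h -> `|c j - F t| <= E t) ->
  `|\sum_(j < N) h * c j - \int[mu]_(t in `]0, N%:R * h]) F t|
    <= \int[mu]_(t in `]0, N%:R * h]) E t.
Proof.
move=> h0 iF iE cFE.
have itg x y f : 0 <= x -> mu.-integrable `]0, +oo[ (EFin \o f) ->
    mu.-integrable `]x, y] (EFin \o f).
  by move=> x0; apply: integrableS => //; exact: subset_oc_pos.
elim: N => [|N IHN].
  by rewrite big_ord0 mul0r set_itv_ge ?bnd_simp ?ltxx// !Rintegral_set0 subrr normr0.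
have N0 : 0 <= N%:R * h by rewrite mulr_ge0// ltW.
have NS : N%:R * h <= N.+1%:R * h by rewrite ler_pM2r// ler_nat.
have splitP : `]0, N.+1%:R * h]%classic =
    `]0, N%:R * h] `|` `]N%:R * h, N.+1%:R * h].
  by rewrite -itv_bndbnd_setU ?bnd_simp.
have dis : [disjoint `]0, N%:R * h] & `]N%:R * h, N.+1%:R * h]].
  apply/disj_setPLR => t/=; rewrite !in_itv/= => /andP[_ th].
  by apply/negP; rewrite negb_and -leNgt th.
have split f : mu.-integrable `]0, +oo[ (EFin \o f) ->
    \int[mu]_(t in `]0, N.+1%:R * h]) f t =
    \int[mu]_(t in `]0, N%:R * h]) f t +
    \int[mu]_(t in `]N%:R * h, N.+1%:R * h]) f t.
  move=> intf; rewrite splitP Rintegral_setU//.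
  by rewrite -splitP; exact: itg.
rewrite big_ord_recr/= !split//.
have -> (x y z w : R) : x + y - (z + w) = (x - z) + (y - w) by ring.
apply: le_trans (ler_normD _ _) _; apply: lerD => //.
have mcell : mu `]N%:R * h, N.+1%:R * h] = h%:E.
  rewrite lebesgue_measure_itv/= lte_fin ltr_pM2r// ltr_nat ltnSn.
  by rewrite -EFinB -mulrBl -natr1 addrAC subrr add0r mul1r.
have icst : mu.-integrable `]N%:R * h, N.+1%:R * h] (EFin \o (fun=> c N)).
  apply/integrableP; split; first exact/measurable_EFinP.
  rewrite integral_cst//= mcell -EFinM; exact: ltry.
have -> : h * c N = \int[mu]_(t in `]N%:R * h, N.+1%:R * h]) c N.
  rewrite Rintegral_cst// mulrC; congr (_ * _).
  exact: (esym (congr1 fine mcell)).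
rewrite -RintegralB//; last exact: itg.
have iB : mu.-integrable `]N%:R * h, N.+1%:R * h] (EFin \o (fun t => c N - F t)).
  by apply: integrable_sub => //; exact: itg.
apply: le_trans (le_normr_Rintegral _ iB) _ => //.
apply: le_Rintegral => //.
- exact: integrable_norm.
- exact: itg.
- by move=> t /=; rewrite in_itv/= => /cFE.
Qed.

Lemma Rintegral_oc_le h G N : mu.-integrable `]0, +oo[ (EFin \o G) ->
    (forall t, 0 < t -> 0 <= G t) ->
  \int[mu]_(t in `]0, N%:R * h]) G t <= \int[mu]_(t in `]0, +oo[) G t.
Proof.
move=> iG G0; have iN : mu.-integrable `]0, N%:R * h] (EFin \o G).
  by apply: integrableS iG => //; exact: subset_oc_pos.
rewrite /Rintegral fine_le//.
- exact: integrable_fin_num.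
- exact: integrable_fin_num.
apply: ge0_subset_integral => //.
- by apply: measurable_int iG.
- by move=> t; rewrite /= in_itv/= andbT lee_fin => /G0.
- exact: subset_oc_pos.
Qed.

(** Absolute convergence: the preceding comparison, applied to [|c j|] against the zero function,
    bounds every partial sum by the integral of [|G|]. *)
Lemma summable_cells h c G : 0 < h ->
    mu.-integrable `]0, +oo[ (EFin \o G) ->
    (forall (j : nat) t, j%:R * h < t <= j.+1%:R * h -> `|c j| <= G t) ->
  cvgn (series (fun j => h * c j)).
Proof.
move=> h0 iG cG; apply: normed_cvg.
apply: nondecreasing_is_cvgn.
  by apply: nondecreasing_series => n _ _; exact: normr_ge0.
exists (\int[mu]_(t in `]0, +oo[) `|G t|) => _ [N _ <-].
rewrite [leLHS](_ : _ = \sum_(j < N) `|h * c j|); last first.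
  by rewrite -(big_mkord xpredT (fun j => `|h * c j|)).
have i0 : mu.-integrable `]0, +oo[ (EFin \o (fun=> 0 : R)) by exact: integrable0.
have inG := integrable_norm iG.
have := @sum_cells_sub_integral_le h (fun j => `|c j|) (fun=> 0)
  (fun t => `|G t|) N h0 i0 inG.
have -> : \int[mu]_(t in `]0, N%:R * h]) (0 : R) = 0.
  by rewrite /Rintegral integral0.
rewrite subr0 => /(_ _)/le_trans H.
under eq_bigr do rewrite normrM (gtr0_norm h0).
apply: le_trans (ler_norm _) (H _ _ _).
- move=> j t jt; rewrite subr0 normr_id (le_trans (cG _ _ jt))//.
  exact: ler_norm.
- by apply: Rintegral_oc_le.
Qed.

Lemma series_cells_sub_integral_le h c F E : 0 < h ->
    mu.-integrable `]0, +oo[ (EFin \o F) ->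
    mu.-integrable `]0, +oo[ (EFin \o E) ->
    (forall (j : nat) t, j%:R * h < t <= j.+1%:R * h -> `|c j - F t| <= E t) ->
    cvgn (series (fun j => h * c j)) ->
  `|limn (series (fun j => h * c j)) - \int[mu]_(t in `]0, +oo[) F t|
    <= \int[mu]_(t in `]0, +oo[) E t.
Proof.
move=> h0 iF iE cFE cvc.
(* Every [t > 0] lies in some cell, where [E t] bounds an absolute value. *)
have E0 t : 0 < t -> 0 <= E t.
  move=> t0; pose j := Num.truncn (t / h).
  (* Cells are open on the left, so a mesh point [jh] belongs to the cell of index [j - 1]. *)
  have [jt|jt] := eqVneq (j%:R * h) t.
    case: j jt => [|j] jt; first by move: t0; rewrite -jt mul0r ltxx.
    apply: le_trans (normr_ge0 _) (cFE j t _).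
    by rewrite -jt lexx andbT ltr_pM2r// ltr_nat.
  apply: le_trans (normr_ge0 _) (cFE j t _).
  have /andP[j1 j2] := @truncn_itv R (t / h) (divr_ge0 (ltW t0) (ltW h0)).
  rewrite lt_neqAle jt/= -ler_pdivlMr// j1/=.
  by rewrite -ler_pdivrMr// ltW.
have cvF : \int[mu]_(t in `]0, N%:R * h]) F t @[N --> \oo] -->
    \int[mu]_(t in `]0, +oo[) F t.
  apply: integral_exhaust_cvg => //.
  - by move=> n; exact: subset_oc_pos.
  - move=> t /=; rewrite in_itv/= andbT => t0.
    exists (Num.truncn (t / h)).+1 => // n /= tn.
    rewrite in_itv/= t0/= -ler_pdivrMr// ltW//.
    by rewrite (lt_le_trans (truncnS_gt _))// ler_nat.
apply: (cvgr_to_le (cvg_norm (cvgB cvc cvF))); apply: nearW => N /=.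
rewrite seriesEord/=.
apply: le_trans (sum_cells_sub_integral_le N h0 iF iE cFE) _.
exact: Rintegral_oc_le.
Qed.

End cells.

(** * Discrete against continuous fractional derivative for Hölder functions *)

Section holder_case.
Context {R : realType}.
Variables (alpha : R).
Hypotheses (alpha_gt0 : 0 < alpha) (alpha_lt1 : alpha < 1).
Implicit Types (beta h t x K : R) (u : R -> R) (n : int) (j : nat).
Local Notation mu := (@lebesgue_measure R).
Local Notation marchaud_integrable u x :=
  (mu.-integrable `]0, +oo[ (EFin \o marchaud_integrand alpha u x)).

(* The [j]-th term of the discrete sum without its factor [1 / Gamma (- alpha)],
   spread uniformly over the cell [jh < t <= (j+1)h]. *)
Definition frac_density h u x j : R :=
  (u (x + j%:R * h) - u x) * (gamma_ratio alpha j / h `^ (1 + alpha)).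

Lemma frac_density0 h u x : frac_density h u x 0 = 0.
Proof. by rewrite /frac_density mul0r addr0 subrr mul0r. Qed.

(** Jensen's inequality at [s = 1] gives [Gamma_int (1 - alpha) >= 1]. *)
Lemma Gamma_oppr_neq0 : Gamma (- alpha) != 0.
Proof.
apply/eqP => G0.
have := Gamma_int_shift_ge alpha_gt0 alpha_lt1.
rewrite Gamma_int1 mulr1 powR1 => G1.
move: G0; rewrite Gamma_oppr// => /eqP.
rewrite oppr_eq0 mulf_eq0 invr_eq0 (gt_eqF alpha_gt0) orbF => /eqP G0.
by move: G1; rewrite G0 ler10.
Qed.

Lemma frac_delta_termE h u n j : 0 < h ->
  frac_delta_term alpha (restr h u) n j =
  h `^ alpha / Gamma (- alpha) * (h * frac_density h u (h * n%:~R) j).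
Proof.
move=> h0; rewrite /frac_delta_term /restr /frac_density.
have -> : h * (n + j%:Z)%:~R = h * n%:~R + j%:R * h.
  by rewrite intrD mulrDr [_ * h]mulrC.
(* At [j = 0] both sides vanish with the increment; the identity between [Lambda] and [gamma_ratio]
   is available from index 1 on. *)
case: j => [|j]; first by rewrite mul0r addr0 subrr !mul0r !mulr0.
rewrite -Lambda_gamma_ratio//.
have -> : h `^ (1 + alpha) = h * h `^ alpha.
  rewrite powRD ?powRr1 ?(ltW h0)//.
  by apply/implyP => _; rewrite gt_eqF.
field.
by rewrite Gamma_oppr_neq0 !gt_eqF// powR_gt0.
Qed.

Lemma series_frac_delta_term h u n : 0 < h ->
  series (frac_delta_term alpha (restr h u) n) =
  series ((h `^ alpha / Gamma (- alpha)) *: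
    (fun j => h * frac_density h u (h * n%:~R) j)).
Proof.
move=> h0; congr series; apply/funext => j.
by rewrite frac_delta_termE.
Qed.

Lemma cvg_frac_delta_term h u n : 0 < h ->
  cvgn (series (fun j => h * frac_density h u (h * n%:~R) j)) ->
  cvgn (series (frac_delta_term alpha (restr h u) n)).
Proof. by move=> h0 cv; rewrite series_frac_delta_term//; exact: is_cvg_seriesZ. Qed.

Lemma frac_delta_rightE h u n : 0 < h ->
  cvgn (series (fun j => h * frac_density h u (h * n%:~R) j)) ->
  frac_delta_right h alpha (restr h u) n = (Gamma (- alpha))^-1 *
    limn (series (fun j => h * frac_density h u (h * n%:~R) j)).
Proof.
move=> h0 cv; rewrite /frac_delta_right series_frac_delta_term// lim_seriesZ//.
rewrite /GRing.scale/= mulrA; congr (_ * _).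
rewrite mulrA mulVf ?mul1r//.
by rewrite gt_eqF// powR_gt0.
Qed.

(** The estimate of [gamma_ratio_sub_powR_le] at [x = t/h], divided by [h^(1+alpha)]. The extra
    power of decay becomes the factor [h/t]. *)
Lemma density_weight_sub_le h j t : 0 < h -> j.+1%:R * h < t <= j.+2%:R * h ->
  `|gamma_ratio alpha j.+1 / h `^ (1 + alpha) - (t `^ (1 + alpha))^-1|
    <= ratio_const alpha * (h / t) / t `^ (1 + alpha).
Proof.
move=> h0 /andP[jt tj].
have t0 : 0 < t by apply: lt_trans jt; rewrite mulr_gt0.
have hp : 0 < h `^ (1 + alpha) by rewrite powR_gt0.
have th0 : 0 < t / h by rewrite divr_gt0.
have := @gamma_ratio_sub_powR_le R alpha j (t / h) alpha_gt0 alpha_lt1.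
rewrite ler_pdivlMr// (ltW jt) ler_pdivrMr// tj => /(_ isT).
have E1 : (t / h) `^ (- (1 + alpha)) = h `^ (1 + alpha) / t `^ (1 + alpha).
  rewrite powRM ?invr_ge0 ?(ltW h0) ?(ltW t0)// powRN mulrC; congr (_ * _).
  by rewrite -powR_inv1 ?(ltW h0)// -powRrM mulrNN mul1r.
have E2 : (t / h) `^ (- (2 + alpha)) =
    (t / h) `^ (- (1 + alpha)) * (h / t).
  by rewrite (@powRN2_split R alpha _ th0) mulrAC -mulrA; field; rewrite !gt_eqF.
rewrite E2 E1 => le1.
have -> : gamma_ratio alpha j.+1 / h `^ (1 + alpha) - (t `^ (1 + alpha))^-1 =
  (gamma_ratio alpha j.+1 - h `^ (1 + alpha) / t `^ (1 + alpha)) / h `^ (1 + alpha).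
  by field; rewrite !gt_eqF ?powR_gt0.
rewrite normrM normfV (gtr0_norm hp) ler_pdivrMr//; apply: le_trans le1 _.
by rewrite le_eqVlt; apply/predU1P; left; ring.
Qed.

Lemma marchaud_integrand_near_le beta h K u x t :
    (forall y z, `|u y - u z| <= K * `|y - z| `^ beta) ->
    0 < t -> t <= h ->
  `|marchaud_integrand alpha u x t| <= K * trunc_weight alpha beta h t.
Proof.
move=> uK t0 th; rewrite /marchaud_integrand /trunc_weight min_l//.
rewrite normrM normfV (ger0_norm (powR_ge0 _ _)) mulrA ler_wpM2r//.
  by rewrite invr_ge0 powR_ge0.
by apply: le_trans (uK _ _) _; rewrite addrAC subrr add0r gtr0_norm.
Qed.

(** On the first cell the discrete term is zero and the integrand alone is bounded. On the others
    the error splits into increment times weight error, and increment error times exact weight. *)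
Lemma density_sub_marchaud_le beta h K u x j t :
    0 < beta -> beta <= 1 -> 0 <= K -> 0 < h ->
    (forall y z, `|u y - u z| <= K * `|y - z| `^ beta) ->
    j%:R * h < t <= j.+1%:R * h ->
  `|frac_density h u x j - marchaud_integrand alpha u x t|
    <= K * (1 + ratio_const alpha) * trunc_weight alpha beta h t.
Proof.
move=> b0 b1 K0 h0 uK jt.
have C0 := ratio_const_ge0 alpha_gt0.
case: j jt => [|j] jt.
  move: jt; rewrite mul0r mul1r => /andP[t0 th].
  rewrite frac_density0 sub0r normrN.
  apply: le_trans (marchaud_integrand_near_le x uK t0 th) _.
  by rewrite ler_wpM2r ?trunc_weight_ge0// ler_peMr// lerDl.
have /andP[jt1 jt2] := jt.
have ht : h < t.
  by apply: le_lt_trans jt1; rewrite ler_peMl ?(ltW h0)// ler1n.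
have t0 : 0 < t by exact: lt_trans ht.
have tp : 0 < t `^ (1 + alpha) by rewrite powR_gt0.
have hb : 0 <= h `^ beta by rewrite powR_ge0.
rewrite /frac_density /marchaud_integrand /trunc_weight min_r ?(ltW ht)//.
set w := gamma_ratio _ _ / _; set v := (t `^ (1 + alpha))^-1.
have v0 : 0 < v by rewrite invr_gt0.
have -> : (u (x + j.+1%:R * h) - u x) * w - (u (x + t) - u x) * v =
  (u (x + j.+1%:R * h) - u x) * (w - v) + (u (x + j.+1%:R * h) - u (x + t)) * v.
  by ring.
apply: le_trans (ler_normD _ _) _; rewrite !normrM.
rewrite (gtr0_norm v0).
have A1 : `|u (x + j.+1%:R * h) - u (x + t)| <= K * h `^ beta.
  apply: le_trans (uK _ _) _; rewrite ler_wpM2l//.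
  apply: ge0_ler_powR; rewrite ?nnegrE ?(ltW b0) ?(ltW h0)//.
  have -> : x + j.+1%:R * h - (x + t) = - (t - j.+1%:R * h) by ring.
  rewrite normrN ger0_norm ?subr_ge0 ?(ltW jt1)//.
  by rewrite lerBlDr (le_trans jt2)// -[j.+2%:R]nat1r mulrDl mul1r.
have A2 : `|u (x + j.+1%:R * h) - u x| <= K * t `^ beta.
  apply: le_trans (uK _ _) _; rewrite ler_wpM2l//.
  apply: ge0_ler_powR; rewrite ?nnegrE ?(ltW b0) ?(ltW t0)//.
  rewrite addrAC subrr add0r ger0_norm ?(ltW jt1)//.
  by rewrite mulr_ge0// ltW.
(* Here [beta <= 1] and [h < t] are used: the gain [h/t] turns [t^beta] into [h^beta]. *)
have A3 : t `^ beta * (h / t) <= h `^ beta.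
  have -> : t `^ beta = h `^ beta * (t / h) `^ beta.
    by rewrite -powRM ?divr_ge0 ?(ltW h0) ?(ltW t0)// mulrC divfK// gt_eqF.
  rewrite -mulrA ler_piMr//.
  have th1 : 1 <= t / h by rewrite ler_pdivlMr// mul1r ltW.
  have -> : h / t = (t / h)^-1 by rewrite invf_div.
  by rewrite ler_pdivrMr ?divr_gt0// mul1r ler1_powR.
have A4 : `|w - v| <= ratio_const alpha * (h / t) * v.
  exact: density_weight_sub_le.
have -> : K * (1 + ratio_const alpha) * (h `^ beta * v) =
  K * ratio_const alpha * h `^ beta * v + K * h `^ beta * v by ring.
apply: lerD; last by rewrite ler_pM2r.
apply: (@le_trans _ _ (K * t `^ beta * (ratio_const alpha * (h / t) * v))).
  by apply: ler_pM.
have -> : K * t `^ beta * (ratio_const alpha * (h / t) * v) =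
  (K * ratio_const alpha * v) * (t `^ beta * (h / t)) by ring.
have -> : K * ratio_const alpha * h `^ beta * v =
  (K * ratio_const alpha * v) * h `^ beta by ring.
by rewrite ler_wpM2l// (mulr_ge0 (mulr_ge0 K0 C0) (ltW v0)).
Qed.

(** The terms are dominated by the Marchaud integrand plus the cell error; integrability of the
    former is assumed because [u] may be unbounded. *)
Lemma holder_series_cvg beta h K u x :
    0 < beta -> beta <= 1 -> alpha < beta -> 0 <= K -> 0 < h ->
    (forall y z, `|u y - u z| <= K * `|y - z| `^ beta) ->
    marchaud_integrable u x ->
  cvgn (series (fun j => h * frac_density h u x j)).
Proof.
move=> b0 b1 ab K0 h0 uK iu.
apply: (@summable_cells _ _ _ (fun t => `|marchaud_integrand alpha u x t| +
    K * (1 + ratio_const alpha) * trunc_weight alpha beta h t)) => //.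
- apply: integrable_add => //; first exact: integrable_norm.
  by apply: integrable_scale => //; exact: integrable_trunc_weight.
- move=> j t jt; rewrite -lerBlDl.
  apply: le_trans (lerB_dist _ _) _.
  exact: density_sub_marchaud_le.
Qed.

(** The constant of the integral of [trunc_weight]: the first summand comes from [t <= h], the
    second from [t > h]. *)
Definition weight_const beta : R := (beta - alpha)^-1 + alpha^-1.

Definition holder_const beta : R :=
  `|(Gamma (- alpha))^-1| * ((1 + ratio_const alpha) * weight_const beta).

Lemma holder_estimate beta h K u n :
    0 < beta -> beta <= 1 -> alpha < beta -> 0 <= K -> 0 < h ->
    (forall y z, `|u y - u z| <= K * `|y - z| `^ beta) ->
    marchaud_integrable u (h * n%:~R) ->
  `|frac_delta_right h alpha (restr h u) n - restr h (marchaud_right alpha u) n|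
    <= holder_const beta * K * h `^ (beta - alpha).
Proof.
move=> b0 b1 ab K0 h0 uK iu.
have cv := holder_series_cvg b0 b1 ab K0 h0 uK iu.
rewrite frac_delta_rightE// /restr /marchaud_right -mulrBr normrM.
rewrite /holder_const -!mulrA ler_wpM2l//.
pose E t := K * (1 + ratio_const alpha) * trunc_weight alpha beta h t.
have iE : mu.-integrable `]0, +oo[ (EFin \o E).
  by apply: integrable_scale => //; exact: integrable_trunc_weight.
apply: (@le_trans _ _ (\int[mu]_(t in `]0, +oo[) E t)).
  apply: series_cells_sub_integral_le => // j t jt.
  exact: density_sub_marchaud_le.
rewrite RintegralZl//; last exact: integrable_trunc_weight.
have -> : (1 + ratio_const alpha) * (weight_const beta * (K * h `^ (beta - alpha))) =
  K * (1 + ratio_const alpha) * (weight_const beta * h `^ (beta - alpha)) by ring.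
rewrite ler_wpM2l ?mulr_ge0 ?addr_ge0 ?ratio_const_ge0//.
exact: Rintegral_trunc_weight_le.
Qed.

End holder_case.

(** * Difference quotients of functions with Hölder derivative *)

Section C1_case.
Context {R : realType}.
Implicit Types (alpha beta h t x y z e K : R) (u f g dg : R -> R) (n : int) (j : nat).
Local Notation mu := (@lebesgue_measure R).

(** The endpoints come in either order, so that steps [e] of both signs are covered; of the position
    of [c] only its distance to [a] is kept. *)
Lemma MVT_unordered g dg (a b : R) : (forall x : R, is_derive x 1 g (dg x)) ->
  exists2 c, `|c - a| <= `|b - a| & g b - g a = dg c * (b - a).
Proof.
move=> dgg.
have cg x : {for x, continuous g}.
  by apply/differentiable_continuous/derivable1_diffP; case: (dgg x).
have [ab|/ltW ba] := leP a b.
- have [|c] := @MVT_segment R g dg a b ab => //.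
    exact: continuous_subspaceT.
  rewrite in_itv/= => /andP[ac cb] gE; exists c => //.
  by rewrite !ger0_norm ?subr_ge0// lerD2r.
- have [|c] := @MVT_segment R g dg b a ba => //.
    exact: continuous_subspaceT.
  rewrite in_itv/= => /andP[bc ca] gE; exists c => //.
    by rewrite !ler0_norm ?subr_le0// lerN2 lerD2r.
  by rewrite -opprB gE -mulrN opprB.
Qed.

Lemma is_derive_translate g dg a x : (forall y : R, is_derive y 1 g (dg y)) ->
  is_derive x 1 (fun s => g (a + s)) (dg (a + x)).
Proof.
move=> dgg.
have -> : (fun s => g (a + s)) = g \o shift a by apply/funext => s /=; rewrite addrC.
rewrite -[X in is_derive _ _ _ X]mulr1.
apply: (is_derive1_comp (b := 1)); last exact: is_derive_shift.
by rewrite /= addrC.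
Qed.

Definition diff_quot e u x : R := (u (x + e) - u x) / e.

Lemma continuous_holder beta K f : 0 < beta -> 0 <= K ->
  (forall y z, `|f y - f z| <= K * `|y - z| `^ beta) -> continuous f.
Proof.
move=> b0 K0 fK x; apply/cvgrPdist_le => e e0.
have K1 : 0 < K + 1 by rewrite ltr_wpDl.
near=> y.
apply: le_trans (fK _ _) _.
have xy : `|x - y| <= (e / (K + 1)) `^ beta^-1.
  near: y; apply: cvgr_dist_le; first exact: cvg_id.
  by rewrite powR_gt0// divr_gt0.
apply: (@le_trans _ _ ((K + 1) * `|x - y| `^ beta)).
  by rewrite ler_wpM2r ?powR_ge0// lerDl.
rewrite mulrC -ler_pdivlMr//.
have -> : e / (K + 1) = ((e / (K + 1)) `^ beta^-1) `^ beta.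
  by rewrite -powRrM mulVf ?gt_eqF// powRr1// ltW// divr_gt0.
by apply: ge0_ler_powR; rewrite ?nnegrE ?(ltW b0)// ?normr_ge0// powR_ge0.
Unshelve. all: by end_near. Qed.

Lemma measurable_marchaud_integrand alpha f x (D : set R) : continuous f ->
  measurable D -> measurable_fun D (marchaud_integrand alpha f x).
Proof.
move=> cf mD; apply: measurable_funS (@subsetT _ D) _ => //.
apply: measurable_funM.
- apply: measurable_funB => //; apply: continuous_measurable_fun => t.
  apply: continuous_comp; last exact: cf.
  by apply: continuousD; [exact: cst_continuous | exact: cvg_id].
- under eq_fun do rewrite -powRN.
  exact: measurable_powR.
Qed.

Section estimates.
Variables (beta K : R) (u du : R -> R).
Hypotheses (beta_gt0 : 0 < beta) (beta_le1 : beta <= 1) (K_ge0 : 0 <= K).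
Hypothesis u_du : forall x : R, is_derive x 1 u (du x).
Hypothesis du_holder : forall y z, `|du y - du z| <= K * `|y - z| `^ beta.

Lemma diff_quot_sub_deriv_le e x : e != 0 ->
  `|diff_quot e u x - du x| <= K * `|e| `^ beta.
Proof.
move=> e0; have [c] := MVT_unordered x (x + e) u_du.
rewrite addrAC subrr add0r => ce uE.
rewrite /diff_quot uE mulfK//; apply: le_trans (du_holder _ _) _.
rewrite ler_wpM2l//.
by apply: ge0_ler_powR; rewrite ?nnegrE ?(ltW beta_gt0)// normr_ge0.
Qed.

(** The mean value theorem is applied once, to [s |-> u (y + s) - u (z + s)]. Both derivatives are
    thus taken at the same offset [c], and the constant stays [K]. *)
Lemma diff_quot_holder e y z : e != 0 ->
  `|diff_quot e u y - diff_quot e u z| <= K * `|y - z| `^ beta.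
Proof.
move=> e0.
have dgg (s : R) : is_derive s 1 (fun s => u (y + s) - u (z + s)) (du (y + s) - du (z + s)).
  by apply: is_deriveB; exact: is_derive_translate.
have [c _] := MVT_unordered 0 e dgg.
rewrite subr0 !addr0 => uE.
have -> : diff_quot e u y - diff_quot e u z =
    ((u (y + e) - u (z + e)) - (u y - u z)) / e by rewrite /diff_quot; ring.
rewrite uE mulfK//; apply: le_trans (du_holder _ _) _.
by have -> : y + c - (z + c) = y - z by ring.
Qed.

(** For [t <= |e|] each increment is bounded by its Hölder constant; for [t > |e|] the terms are
    regrouped by point, and the quotient is close to the derivative at both [x + t] and [x]. *)
Lemma diff_quot_increment_le e x t : e != 0 -> 0 < t ->
  `|(diff_quot e u (x + t) - diff_quot e u x) - (du (x + t) - du x)|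
    <= 2 * K * Num.min t `|e| `^ beta.
Proof.
move=> e0 t0; rewrite -mulrA mulr_natl mulr2n.
have [te|et] := leP t `|e|.
- apply: le_trans (ler_normB _ _) _; apply: lerD.
    apply: le_trans (diff_quot_holder _ _ e0) _.
    by rewrite addrAC subrr add0r gtr0_norm.
  apply: le_trans (du_holder _ _) _.
  by rewrite addrAC subrr add0r gtr0_norm.
- have -> : diff_quot e u (x + t) - diff_quot e u x - (du (x + t) - du x) =
    (diff_quot e u (x + t) - du (x + t)) - (diff_quot e u x - du x) by ring.
  by apply: le_trans (ler_normB _ _) _; apply: lerD; exact: diff_quot_sub_deriv_le.
Qed.

Variable alpha : R.
Hypotheses (alpha_gt0 : 0 < alpha) (alpha_lt1 : alpha < 1).
Hypothesis alpha_beta : alpha < beta.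

Lemma marchaud_integrand_diff_quot e x t :
  marchaud_integrand alpha (diff_quot e u) x t =
  e^-1 * (marchaud_integrand alpha u (x + e) t - marchaud_integrand alpha u x t).
Proof.
by rewrite /marchaud_integrand /diff_quot (addrAC x e t); ring.
Qed.

Lemma marchaud_diff_quot_sub_le e x t : e != 0 -> 0 < t ->
  `|marchaud_integrand alpha (diff_quot e u) x t - marchaud_integrand alpha du x t|
    <= 2 * K * trunc_weight alpha beta `|e| t.
Proof.
move=> e0 t0; rewrite /marchaud_integrand -mulrBl normrM normfV.
rewrite (ger0_norm (powR_ge0 _ _)) /trunc_weight mulrA ler_wpM2r//.
  by rewrite invr_ge0 powR_ge0.
exact: diff_quot_increment_le.
Qed.

Hypothesis u_def : marchaud_defined alpha u.

Lemma diff_quot_marchaud_defined e : marchaud_defined alpha (diff_quot e u).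
Proof.
move=> x.
rewrite (_ : marchaud_integrand _ _ _ = (fun t => e^-1 *
  (marchaud_integrand alpha u (x + e) t - marchaud_integrand alpha u x t))).
  by apply: integrable_scale => //; apply: integrable_sub => //; exact: u_def.
by apply/funext => t; rewrite marchaud_integrand_diff_quot.
Qed.

Lemma marchaud_right_diff_quot e x :
  marchaud_right alpha (diff_quot e u) x =
  e^-1 * (marchaud_right alpha u (x + e) - marchaud_right alpha u x).
Proof.
rewrite /marchaud_right; under eq_Rintegral do rewrite marchaud_integrand_diff_quot.
rewrite RintegralZl//; last by apply: integrable_sub => //; exact: u_def.
by rewrite RintegralB//; ring.
Qed.

(** Comparison with the difference quotient of step 1, whose integrand is integrable as a
    combination of those of [u] at [x + 1] and [x]. *)
Lemma deriv_marchaud_defined : marchaud_defined alpha du.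
Proof.
move=> x.
apply: (@dominated_integrable_real _ (measurableTypeR R) R mu _ _
  (marchaud_integrand alpha du x)
  (fun t => `|marchaud_integrand alpha (diff_quot 1 u) x t| +
    2 * K * trunc_weight alpha beta `|1| t)) => //.
- apply: measurable_marchaud_integrand => //.
  exact: continuous_holder beta_gt0 K_ge0 du_holder.
- move=> t /=; rewrite in_itv/= andbT => t0.
  rewrite -lerBlDl; apply: le_trans (lerB_dist _ _) _.
  by rewrite distrC; apply: marchaud_diff_quot_sub_le => //; exact: oner_neq0.
- apply: integrable_add => //.
    by apply: integrable_norm; exact: diff_quot_marchaud_defined.
  apply: integrable_scale => //; apply: integrable_trunc_weight => //.
  by rewrite normr1.
Qed.

Lemma marchaud_right_diff_quot_sub_le e x : e != 0 ->
  `|e^-1 * (marchaud_right alpha u (x + e) - marchaud_right alpha u x)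
    - marchaud_right alpha du x|
    <= `|(Gamma (- alpha))^-1| * (2 * weight_const alpha beta) * K *
       `|e| `^ (beta - alpha).
Proof.
move=> e0; have ne0 : 0 < `|e| by rewrite normr_gt0.
rewrite -marchaud_right_diff_quot /marchaud_right -mulrBr normrM -!mulrA.
rewrite ler_wpM2l//.
have iq := diff_quot_marchaud_defined e x; have id := deriv_marchaud_defined x.
rewrite -RintegralB//.
have iB : mu.-integrable `]0, +oo[ (EFin \o (fun t =>
    marchaud_integrand alpha (diff_quot e u) x t - marchaud_integrand alpha du x t)).
  exact: integrable_sub.
have iw : mu.-integrable `]0, +oo[ (EFin \o trunc_weight alpha beta `|e|).
  exact: integrable_trunc_weight.
apply: le_trans (le_normr_Rintegral _ iB) _ => //.
apply: (@le_trans _ _ (\int[mu]_(t in `]0, +oo[)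
    (2 * K * trunc_weight alpha beta `|e| t))).
  apply: le_Rintegral => //.
  - exact: integrable_norm.
  - exact: integrable_scale.
  - move=> t /=; rewrite in_itv/= andbT => t0.
    exact: marchaud_diff_quot_sub_le.
rewrite RintegralZl//.
have -> : 2 * (weight_const alpha beta * (K * `|e| `^ (beta - alpha))) =
  2 * K * (weight_const alpha beta * `|e| `^ (beta - alpha)) by ring.
rewrite ler_wpM2l ?mulr_ge0//.
exact: Rintegral_trunc_weight_le.
Qed.

(** The preceding bound tends to zero with [e] because [alpha < beta]; this replaces differentiation
    under the integral sign. *)
Lemma is_derive_marchaud_right x :
  is_derive x 1 (marchaud_right alpha u) (marchaud_right alpha du x).
Proof.
set C := `|(Gamma (- alpha))^-1| * (2 * weight_const alpha beta) * K.
have p0 : 0 < beta - alpha by rewrite subr_gt0.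
have w0 : 0 <= weight_const alpha beta.
  by rewrite addr_ge0// invr_ge0 ltW.
have C0 : 0 <= C by rewrite /C !mulr_ge0.
have cv : h^-1 *: ((marchaud_right alpha u \o shift x) (h *: 1) -
    marchaud_right alpha u x) @[h --> 0^'] --> marchaud_right alpha du x.
  apply/cvgrPdist_le => eps eps0.
  have C1 : 0 < C + 1 by rewrite ltr_wpDl.
  near=> e.
  have e0 : e != 0 by near: e; exact: nbhs_dnbhs_neq.
  rewrite distrC /= /GRing.scale/= mulr1 (addrC e).
  apply: le_trans (marchaud_right_diff_quot_sub_le x e0) _.
  rewrite -/C.
  (* The radius solves [(C + 1) |e|^(beta - alpha) = eps]; the added 1 permits the division even if
     [C = 0]. *)
  have ee : `|e| <= (eps / (C + 1)) `^ (beta - alpha)^-1.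
    by near: e; apply: dnbhs0_le; rewrite powR_gt0// divr_gt0.
  apply: (@le_trans _ _ ((C + 1) * `|e| `^ (beta - alpha))).
    by rewrite ler_wpM2r ?powR_ge0// lerDl.
  rewrite mulrC -ler_pdivlMr//.
  have -> : eps / (C + 1) = ((eps / (C + 1)) `^ (beta - alpha)^-1) `^ (beta - alpha).
    by rewrite -powRrM mulVf ?gt_eqF// powRr1// ltW// divr_gt0.
  by apply: ge0_ler_powR; rewrite ?nnegrE ?(ltW p0)// ?normr_ge0// powR_ge0.
split; first by apply/cvg_ex; exists (marchaud_right alpha du x).
exact: cvg_lim.
Unshelve. all: by end_near. Qed.

(** The mean value theorem moves the mesh point to [x + t], so that the discrete increment is
    controlled by increments occurring in Marchaud integrands. *)
Lemma increment_cell_le h x j t : 0 < h -> j%:R * h < t <= j.+1%:R * h ->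
  `|u (x + j%:R * h) - u x|
    <= `|u (x + t) - u x| + h * (`|du (x + t) - du x| + (`|du x| + K * h `^ beta)).
Proof.
move=> h0 /andP[jt tj].
have [c] := MVT_unordered (x + t) (x + j%:R * h) u_du.
have -> : x + j%:R * h - (x + t) = - (t - j%:R * h) by ring.
have d0 : 0 <= t - j%:R * h by rewrite subr_ge0 ltW.
have dh : t - j%:R * h <= h.
  by rewrite lerBlDr (le_trans tj)// -[j.+1%:R]nat1r mulrDl mul1r.
rewrite normrN (ger0_norm d0) => ct uE.
have -> : u (x + j%:R * h) - u x =
  (u (x + t) - u x) + (u (x + j%:R * h) - u (x + t)) by ring.
apply: le_trans (ler_normD _ _) _; rewrite lerD2l uE mulrN normrN normrM.
rewrite (ger0_norm d0) mulrC; apply: ler_pM => //.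
have -> : du c = (du (x + t) - du x) + (du x + (du c - du (x + t))) by ring.
apply: le_trans (ler_normD _ _) _; rewrite lerD2l.
apply: le_trans (ler_normD _ _) _; rewrite lerD2l.
apply: le_trans (du_holder _ _) _; rewrite ler_wpM2l//.
apply: ge0_ler_powR; rewrite ?nnegrE ?(ltW beta_gt0)// ?normr_ge0// ?(ltW h0)//.
exact: le_trans ct dh.
Qed.

Lemma frac_density_weight_le h j t : 0 < h -> j.+1%:R * h < t <= j.+2%:R * h ->
  gamma_ratio alpha j.+1 / h `^ (1 + alpha)
    <= (1 + ratio_const alpha) / t `^ (1 + alpha).
Proof.
move=> h0 jt; have := density_weight_sub_le alpha_gt0 alpha_lt1 h0 jt.
have /andP[jt1 jt2] := jt.
have ht : h < t.
  by apply: le_lt_trans jt1; rewrite ler_peMl ?(ltW h0)// ler1n.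
have t0 : 0 < t by exact: lt_trans ht.
have C0 := ratio_const_ge0 alpha_gt0.
have v0 : 0 <= (t `^ (1 + alpha))^-1 by rewrite invr_ge0 powR_ge0.
move=> H; rewrite mulrDl mul1r -lerBlDl.
apply: le_trans (ler_norm _) _; apply: le_trans H _.
rewrite ler_wpM2r// ler_piMr// ler_pdivrMr// mul1r ltW//.
Qed.

(** A Hölder bound on [du] gives no global Hölder bound on [u], so the domination rests on the
    Marchaud integrability of [u] and of [du]. The remaining constant [M] is carried by the weight
    of exponent 1, integrable since [alpha < 1]. *)
Lemma C1_series_cvg h x : 0 < h ->
  cvgn (series (fun j => h * frac_density alpha h u x j)).
Proof.
move=> h0; pose M := `|du x| + K * h `^ beta.
have C0 := ratio_const_ge0 alpha_gt0.
have M0 : 0 <= M by rewrite addr_ge0// mulr_ge0// powR_ge0.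
pose G t := (1 + ratio_const alpha) * (`|marchaud_integrand alpha u x t| +
  h * `|marchaud_integrand alpha du x t| + M * trunc_weight alpha 1 h t).
apply: (@summable_cells _ _ _ G) => //.
  apply: integrable_scale => //; apply: integrable_add => //.
    apply: integrable_add => //; first by apply: integrable_norm; exact: u_def.
    apply: integrable_scale => //; apply: integrable_norm.
    exact: deriv_marchaud_defined.
  by apply: integrable_scale => //; exact: integrable_trunc_weight.
move=> [|j] t jt.
  rewrite frac_density0 normr0 /G; apply: mulr_ge0; first exact: addr_ge0.
  apply: addr_ge0; last by rewrite mulr_ge0 ?trunc_weight_ge0.
  by rewrite addr_ge0// mulr_ge0// ltW.
have /andP[jt1 jt2] := jt.
have ht : h < t.
  by apply: le_lt_trans jt1; rewrite ler_peMl ?(ltW h0)// ler1n.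
have t0 : 0 < t by exact: lt_trans ht.
have w0 : 0 <= gamma_ratio alpha j.+1 / h `^ (1 + alpha).
  by rewrite divr_ge0 ?gamma_ratio_ge0 ?powR_ge0.
rewrite /frac_density normrM (ger0_norm w0).
apply: le_trans (ler_pM _ w0 (increment_cell_le x h0 jt) (frac_density_weight_le h0 jt)) _ => //.
rewrite -/M /G /marchaud_integrand !normrM normfV (ger0_norm (powR_ge0 _ _)).
(* For [t > h] this weight is [h / t^(1+alpha)], exactly the kernel times the factor [h] in front of
   [M]. *)
rewrite /trunc_weight min_r ?(ltW ht)// powRr1 ?(ltW h0)//.
by rewrite le_eqVlt; apply/predU1P; left; ring.
Qed.

Lemma C1_estimate h n : 0 < h ->
  `|- delta_right h (frac_delta_right h alpha (restr h u)) n
    - restr h (derive1 (marchaud_right alpha u)) n|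
    <= (holder_const alpha beta + `|(Gamma (- alpha))^-1| * (2 * weight_const alpha beta))
       * K * h `^ (beta - alpha).
Proof.
move=> h0; have hn0 : h != 0 by rewrite gt_eqF.
set x := h * n%:~R.
have xS : h * (n + 1)%:~R = x + h by rewrite intrD mulrDr mulr1.
have cu y := @C1_series_cvg h y h0.
have vK y z := @diff_quot_holder h y z hn0.
have iv := diff_quot_marchaud_defined h (h * n%:~R).
have cv := holder_series_cvg alpha_gt0 alpha_lt1 beta_gt0 beta_le1 alpha_beta
  K_ge0 h0 vK iv.
have := holder_estimate alpha_gt0 alpha_lt1 beta_gt0 beta_le1 alpha_beta
  K_ge0 h0 vK iv.
have -> : frac_delta_right h alpha (restr h (diff_quot h u)) n =
    - delta_right h (frac_delta_right h alpha (restr h u)) n.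
  rewrite /delta_right !frac_delta_rightE// xS -/x.
  have -> : (fun j => h * frac_density alpha h (diff_quot h u) x j) =
    h^-1 *: ((fun j => h * frac_density alpha h u (x + h) j) -
             (fun j => h * frac_density alpha h u x j)).
    apply/funext => j; rewrite /frac_density /diff_quot.
    rewrite -[RHS]/(h^-1 * (_ - _)) (addrAC x h).
    by ring.
  (* Splitting the limit needs convergence of the series of [u] at [x + h] and at [x] separately. *)
  rewrite lim_seriesZ; last by apply: is_cvg_seriesB; exact: cu.
  rewrite lim_seriesB//.
  by rewrite /GRing.scale/=; ring.
rewrite [restr h (marchaud_right _ _) n]/restr marchaud_right_diff_quot -/x => est1.
have est2 := marchaud_right_diff_quot_sub_le x hn0.
have dM := is_derive_marchaud_right x.
rewrite /restr -/x derive1E derive_val.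
rewrite (gtr0_norm h0) in est2.
(* The intermediate value is the difference quotient of [marchaud_right alpha u]: [est1] bounds the
   discretization error, [est2] the distance to the derivative. *)
apply: le_trans (ler_distD (h^-1 * (marchaud_right alpha u (x + h) -
  marchaud_right alpha u x)) _ _) _.
apply: le_trans (lerD est1 est2) _.
by rewrite le_eqVlt; apply/predU1P; left; ring.
Qed.

End estimates.
End C1_case.

(** * Extended-real norms and seminorms turned into real bounds *)

Section seminorms.
Context {R : realType}.
Implicit Types (alpha beta h t x y z K M : R) (u : R -> R) (w : int -> R).
Local Notation mu := (@lebesgue_measure R).

Lemma holder_seminorm_ge0 beta u : (0 <= holder_seminorm beta u)%E.
Proof.
apply: le_trans (ereal_sup_ubound _); last first.
  by exists (0, 1) => //=; rewrite eq_sym oner_neq0.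
by rewrite lee_fin divr_ge0// powR_ge0.
Qed.

Lemma holder_seminormP beta u : (holder_seminorm beta u < +oo)%E ->
  exists2 K, holder_seminorm beta u = K%:E &
    0 <= K /\ forall y z, `|u y - u z| <= K * `|y - z| `^ beta.
Proof.
move=> fin; have s0 := holder_seminorm_ge0 beta u.
exists (fine (holder_seminorm beta u)).
  by rewrite fineK// ge0_fin_numE.
split; first exact: fine_ge0.
move=> y z; have [->|yz] := eqVneq y z.
  by rewrite subrr normr0 mulr_ge0 ?fine_ge0 ?powR_ge0.
rewrite -ler_pdivrMr ?powR_gt0 ?normr_gt0 ?subr_eq0//.
rewrite -lee_fin fineK ?ge0_fin_numE//.
by apply: ereal_sup_ubound; exists (y, z).
Qed.

Lemma linfty_norm_le w M : (forall n, `|w n| <= M) -> (linfty_norm w <= M%:E)%E.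
Proof. by move=> wM; apply: ge_ereal_sup => _ [n _ <-]; rewrite lee_fin. Qed.

Lemma holder_norm_Lnorm_lty k beta u : (holder_norm k beta u < +oo)%E ->
  ('N[mu]_+oo [EFin \o u] < +oo)%E.
Proof.
apply: le_lt_trans; rewrite /holder_norm big_nat_recl// -addeA leeDl//.
apply: adde_ge0; last exact: holder_seminorm_ge0.
by apply: sume_ge0 => i _; exact: Lnorm_ge0.
Qed.

(** If [|u y|] exceeded the essential supremum, continuity would put an interval []y, y + e[] of
    positive length inside a null set. *)
Lemma Lnorm_continuous_bounded u : continuous u ->
    ('N[mu]_+oo [EFin \o u] < +oo)%E -> exists M, forall x, `|u x| <= M.
Proof.
move=> cu; have mu0 : (0 < mu setT)%E by rewrite -set_itvNyy lebesgue_measure_itv/= ltry.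
rewrite Lnorm.unlock /= mu0 => fin.
have e0 : (0 <= ess_sup mu (abse \o (EFin \o u)))%E.
  by apply: ess_sup_gee => //; apply/nearW => x /=; rewrite lee_fin.
exists (fine (ess_sup mu (abse \o (EFin \o u)))) => y.
rewrite leNgt; apply/negP; set M := fine _ => My.
have [A [mA A0 sA]] := ess_sup_ge mu (abse \o (EFin \o u)).
have : \forall x \near y, M < `|u x|.
  exact: (cvgr_norm_gt _ (cu y) _ My).
move/nbhs_ballP => [e /= e0' eA].
have subA : `]y, y + e[ `<=` A.
  move=> x; rewrite /= in_itv/= => /andP[yx xe].
  apply: sA => /=; apply/negP; rewrite -ltNge.
  rewrite -[X in (X < _)%E]fineK ?ge0_fin_numE//.
  rewrite lte_fin; apply: eA; rewrite /ball/= ltr0_norm ?subr_lt0//.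
  by rewrite opprB ltrBlDl.
have : (mu `]y, (y + e)%R[%classic <= 0)%E.
  by rewrite -A0; apply: le_measure => //; rewrite inE.
rewrite lebesgue_measure_itv/= lte_fin ltrDl e0' -EFinB lee_fin.
by rewrite addrAC subrr add0r leNgt e0'.
Qed.

End seminorms.

(** * Convergence of the Marchaud integral for bounded functions *)

Section bounded_marchaud.
Context {R : realType}.
Implicit Types (alpha b x y z A M : R) (u : R -> R).
Local Notation mu := (@lebesgue_measure R).

Lemma marchaud_defined_increment alpha b u x A :
    0 < alpha -> alpha < b -> continuous u ->
    (forall t, 0 < t -> `|u (x + t) - u x| <= A * Num.min t 1 `^ b) ->
  mu.-integrable `]0, +oo[ (EFin \o marchaud_integrand alpha u x).
Proof.
move=> a0 ab cu uA.
apply: (@dominated_integrable_real _ (measurableTypeR R) R mu _ _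
  (marchaud_integrand alpha u x) (fun t => A * trunc_weight alpha b 1 t)) => //.
- apply: measurable_funS (@subsetT _ _) _ => //.
  exact: measurable_marchaud_integrand.
- move=> t /=; rewrite in_itv/= andbT => t0.
  rewrite /marchaud_integrand /trunc_weight normrM normfV.
  rewrite (ger0_norm (powR_ge0 _ _)) mulrA ler_wpM2r//.
    by rewrite invr_ge0 powR_ge0.
  exact: uA.
- by apply: integrable_scale => //; exact: integrable_trunc_weight.
Qed.

(** A local Hölder bound at [x], of exponent above [alpha], settles [t <= 1]; beyond, increments are
    at most [2 M] and the kernel is integrable. *)
Lemma bounded_marchaud_defined alpha b u M :
    0 < alpha -> alpha < b -> continuous u -> (forall x, `|u x| <= M) ->
    (forall x, exists2 A, 0 <= A &
      forall t, 0 < t -> t <= 1 -> `|u (x + t) - u x| <= A * t `^ b) ->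
  marchaud_defined alpha u.
Proof.
move=> a0 ab cu uM locA x; have [A A0 uA] := locA x.
have M0 : 0 <= M by exact: le_trans (normr_ge0 _) (uM 0).
apply: (@marchaud_defined_increment _ b _ _ (A + 2 * M)) => // t t0.
have [t1|t1] := leP t 1.
  apply: le_trans (uA t t0 t1) _.
  by rewrite ler_wpM2r ?powR_ge0// lerDl mulr_ge0.
rewrite powR1 mulr1; apply: le_trans (ler_normB _ _) _.
apply: le_trans (lerD (uM _) (uM _)) _.
by lra.
Qed.

End bounded_marchaud.

Unset Implicit Arguments.
Set Strict Implicit.

Theorem theorem3 (R : realType) (alpha beta : R)
    (beta_gt0 : 0 < beta) (beta_le1 : beta <= 1)
    (alpha_gt0 : 0 < alpha) (alpha_lt1 : alpha < 1) :
  (alpha < beta ->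
   exists C : R, 0 < C /\
   forall u : R -> R, holder_class 0 beta u ->
     ((holder_norm 0 beta u < +oo)%E -> marchaud_defined alpha u) /\
     (marchaud_defined alpha u ->
      forall h : R, 0 < h ->
        frac_delta_defined alpha (restr h u) /\
        (linfty_norm (fun n : int => (
           frac_delta_right h alpha (restr h u) n
           - restr h (marchaud_right alpha u) n)%R)
         <= C%:E * holder_seminorm beta u * (h `^ (beta - alpha))%:E)%E))
  /\
  (alpha < beta ->
   exists C : R, 0 < C /\
   forall u : R -> R, holder_class 1 beta u ->
     ((holder_norm 1 beta u < +oo)%E -> marchaud_defined alpha u) /\
     (marchaud_defined alpha u ->
      (forall x : R, derivable (marchaud_right alpha u) x 1) /\
      forall h : R, 0 < h ->
        frac_delta_defined alpha (restr h u) /\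
        (linfty_norm (fun n : int => (
           - delta_right h (frac_delta_right h alpha (restr h u)) n
           - restr h (derive1 (marchaud_right alpha u)) n)%R)
         <= C%:E * holder_seminorm beta (derive1 u) * (h `^ (beta - alpha))%:E)%E)).
Proof.
split=> ab.
- have hc0 : 0 <= holder_const alpha beta.
    rewrite /holder_const !mulr_ge0 ?addr_ge0 ?ratio_const_ge0//.
      by rewrite invr_ge0 subr_ge0 ltW.
    by rewrite invr_ge0 ltW.
  (* Adding 1 makes the constant strictly positive from mere nonnegativity. *)
  exists (holder_const alpha beta + 1); split; first by rewrite ltr_wpDl.
  move=> u [[_ cu] /holder_seminormP[K KE [K0 uK]]]; rewrite /= in cu KE uK.
  split=> [/holder_norm_Lnorm_lty /(Lnorm_continuous_bounded cu)[M uM]|um h h0].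
    apply: (bounded_marchaud_defined alpha_gt0 ab cu uM) => x.
    exists K => // t t0 _; apply: le_trans (uK _ _) _.
    by rewrite addrAC subrr add0r gtr0_norm.
  split.
    move=> n; apply: cvg_frac_delta_term => //.
    exact: (holder_series_cvg _ _ beta_gt0 beta_le1 ab K0 h0 uK).
  rewrite KE -!EFinM; apply: linfty_norm_le => n.
  apply: le_trans (holder_estimate alpha_gt0 alpha_lt1 beta_gt0 beta_le1 ab
    K0 h0 uK (um _)) _.
  by rewrite ler_wpM2r ?powR_ge0// ler_wpM2r// lerDl.
- set C := holder_const alpha beta + `|(Gamma (- alpha))^-1| * (2 * weight_const alpha beta).
  have hc0 : 0 <= C.
    have w0 : 0 <= weight_const alpha beta.
      by rewrite /weight_const addr_ge0// invr_ge0 ?subr_ge0 ltW.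
    have r0 := ratio_const_ge0 alpha_gt0.
    by rewrite /C /holder_const addr_ge0// !mulr_ge0// addr_ge0.
  exists (C + 1); split; first by rewrite ltr_wpDl.
  move=> u [[du cdu] /holder_seminormP[K KE [K0 uK]]]; rewrite /= in cdu KE uK.
  have u_du (x : R) : is_derive x 1 u (derive1 u x).
    by rewrite derive1E; apply: DeriveDef => //; exact: (du 0%N).
  have cu : continuous u.
    by move=> x; apply/differentiable_continuous/derivable1_diffP; case: (u_du x).
  split=> [/holder_norm_Lnorm_lty /(Lnorm_continuous_bounded cu)[M uM]|um].
    apply: (bounded_marchaud_defined alpha_gt0 alpha_lt1 cu uM) => x.
    (* The local exponent is 1: for [t <= 1] the derivative at the intermediate point differs from
       the one at [x] by at most [K]. *)
    exists (`|derive1 u x| + K) => [|t t0 t1]; first by rewrite addr_ge0.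
    have [c] := MVT_unordered x (x + t) u_du.
    rewrite addrAC subrr add0r (gtr0_norm t0) => ct ->.
    rewrite normrM (gtr0_norm t0) powRr1 ?(ltW t0)// ler_wpM2r ?(ltW t0)//.
    rewrite -[derive1 u c](subrK (derive1 u x)) addrC.
    apply: le_trans (ler_normD _ _) _; rewrite lerD2l.
    apply: le_trans (uK _ _) _; rewrite ler_piMr//.
    rewrite [leRHS](_ : 1 = 1 `^ beta); last by rewrite powR1.
    apply: ge0_ler_powR; rewrite ?nnegrE ?(ltW beta_gt0)//.
    exact: le_trans ct t1.
  split.
    move=> x.
    by have [] := is_derive_marchaud_right beta_gt0 K0 u_du uK
      alpha_gt0 ab um x.
  move=> h h0; split.
    move=> n; apply: cvg_frac_delta_term => //.
    exact: (C1_series_cvg beta_gt0 K0 u_du uK alpha_gt0 alpha_lt1 ab um).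
  rewrite KE -!EFinM; apply: linfty_norm_le => n.
  apply: le_trans (C1_estimate beta_gt0 beta_le1 K0 u_du uK
    alpha_gt0 alpha_lt1 ab um n h0) _.
  by rewrite ler_wpM2r ?powR_ge0// ler_wpM2r// lerDl.
Qed.
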